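(* Let $\Omega\subset\mathbb{C}$ be a bounded domain whose boundary is the union of finitely many pairwise disjoint analytic Jordan curves $\gamma_1,\dots,\gamma_m$, $\gamma_j(t)=\Phi_j(e^{it})$. Then the set of $f\in A^\infty(\Omega)$ such that for every $j\in\{1,\dots,m\}$ the restriction $f|_{\gamma_j^*}$ is real analytic at no point of $\gamma_j^*$ is a dense $G_\delta$ subset of $A^\infty(\Omega)$.
   Context: An analytic Jordan curve is $\gamma(t)=\Phi(e^{it})$, $t\in\mathbb{R}$, with $\Phi$ injective holomorphic on an annulus $\{\rho<|z|<R\}$, $0<\rho<1<R$; $\gamma^*$ is its image. $A^\infty(\Omega)$ is the space of holomorphic $f:\Omega\to\mathbb{C}$ such that every derivative $f^{(l)}$, $l=0,1,2,\dots$, extends continuously to $\overline{\Omega}$, with the Fréchet topology given by the seminorms $\sup_{z\in\Omega}|f^{(l)}(z)|$. A function $g:\gamma_j^*\to\mathbb{C}$ is real analytic at $\gamma_j(t_0)$ if there is a power series $\sum_{n\ge0}a_n(t-t_0)^n$ with radius of convergence $\delta>0$ such that $g(\gamma_j(t))=\sum_{n\ge0}a_n(t-t_0)^n$ for all $t\in(t_0-\delta,t_0+\delta)$. *)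

(* Defs.v *)
From Stdlib Require Import Reals.
Open Scope R_scope.

Definition Cpx : Type := (R * R)%type.
Definition Cadd (z w : Cpx) : Cpx := (fst z + fst w, snd z + snd w).
Definition Csub (z w : Cpx) : Cpx := (fst z - fst w, snd z - snd w).
Definition Cmul (z w : Cpx) : Cpx :=
  (fst z * fst w - snd z * snd w, fst z * snd w + snd z * fst w).
Definition RtoC (x : R) : Cpx := (x, 0).
Definition Cnorm (z : Cpx) : R := sqrt (fst z * fst z + snd z * snd z).
Definition Cpow (z : Cpx) (n : nat) : Cpx := Nat.iter n (Cmul z) (1, 0).
Definition Cexpi (t : R) : Cpx := (cos t, sin t).

Definition open_set (D : Cpx -> Prop) : Prop :=
  forall z, D z -> exists r, 0 < r /\ forall w, Cnorm (Csub w z) < r -> D w.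

Definition connected_set (D : Cpx -> Prop) : Prop :=
  forall U V : Cpx -> Prop, open_set U -> open_set V ->
    (forall z, D z -> U z \/ V z) ->
    (forall z, D z -> U z -> V z -> False) ->
    (forall z, D z -> ~ U z) \/ (forall z, D z -> ~ V z).

Definition domain (D : Cpx -> Prop) : Prop :=
  open_set D /\ connected_set D /\ exists z, D z.

Definition bounded_set (D : Cpx -> Prop) : Prop :=
  exists M, forall z, D z -> Cnorm z <= M.

Definition closure (D : Cpx -> Prop) (z : Cpx) : Prop :=
  forall eps, 0 < eps -> exists w, D w /\ Cnorm (Csub w z) < eps.

Definition boundary (D : Cpx -> Prop) (z : Cpx) : Prop :=
  closure D z /\ ~ (exists r, 0 < r /\ forall w, Cnorm (Csub w z) < r -> D w).

Definition continuous_on (D : Cpx -> Prop) (F : Cpx -> Cpx) : Prop :=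
  forall z, D z -> forall eps, 0 < eps -> exists delta, 0 < delta /\
    forall w, D w -> Cnorm (Csub w z) < delta -> Cnorm (Csub (F w) (F z)) < eps.

Definition has_cderiv_at (f : Cpx -> Cpx) (z L : Cpx) : Prop :=
  forall eps, 0 < eps -> exists delta, 0 < delta /\
    forall h, Cnorm h < delta ->
      Cnorm (Csub (Csub (f (Cadd z h)) (f z)) (Cmul L h)) <= eps * Cnorm h.

Definition holomorphic_on (D : Cpx -> Prop) (f : Cpx -> Cpx) : Prop :=
  forall z, D z -> exists L, has_cderiv_at f z L.

Definition is_cderiv_on (D : Cpx -> Prop) (f f' : Cpx -> Cpx) : Prop :=
  forall z, D z -> has_cderiv_at f z (f' z).

Definition annulus (rho Rr : R) (z : Cpx) : Prop := rho < Cnorm z < Rr.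

Definition analytic_Jordan_param (Phi : Cpx -> Cpx) : Prop :=
  exists rho Rr, 0 < rho /\ rho < 1 /\ 1 < Rr /\
    holomorphic_on (annulus rho Rr) Phi /\
    (forall z w, annulus rho Rr z -> annulus rho Rr w -> Phi z = Phi w -> z = w).

Definition curve (Phi : Cpx -> Cpx) (t : R) : Cpx := Phi (Cexpi t).

Definition deriv_tower (Om : Cpx -> Prop) (f : Cpx -> Cpx) (Df : nat -> Cpx -> Cpx) : Prop :=
  (forall z, Om z -> Df O z = f z) /\
  (forall l, is_cderiv_on Om (Df l) (Df (S l))).

Definition extends_continuously (Om : Cpx -> Prop) (g : Cpx -> Cpx) : Prop :=
  exists G, continuous_on (closure Om) G /\ forall z, Om z -> G z = g z.

Definition A_infty (Om : Cpx -> Prop) (f : Cpx -> Cpx) : Prop :=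
  holomorphic_on Om f /\
  exists Df, deriv_tower Om f Df /\ forall l, extends_continuously Om (Df l).

(* basic neighbourhood for the seminorms sup_Om |f^(l)|, l <= N *)
Definition A_ball (Om : Cpx -> Prop) (f : Cpx -> Cpx) (N : nat) (eps : R) (g : Cpx -> Cpx) : Prop :=
  forall Df Dg, deriv_tower Om f Df -> deriv_tower Om g Dg ->
    forall l, (l <= N)%nat -> forall z, Om z -> Cnorm (Csub (Dg l z) (Df l z)) < eps.

Definition A_open (Om : Cpx -> Prop) (U : (Cpx -> Cpx) -> Prop) : Prop :=
  forall f, A_infty Om f -> U f ->
    exists N eps, 0 < eps /\ forall g, A_infty Om g -> A_ball Om f N eps g -> U g.

Definition A_dense (Om : Cpx -> Prop) (S : (Cpx -> Cpx) -> Prop) : Prop :=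
  forall f, A_infty Om f -> forall N eps, 0 < eps ->
    exists g, A_infty Om g /\ S g /\ A_ball Om f N eps g.

Definition A_Gdelta (Om : Cpx -> Prop) (S : (Cpx -> Cpx) -> Prop) : Prop :=
  exists U : nat -> (Cpx -> Cpx) -> Prop, (forall n, A_open Om (U n)) /\
    forall f, A_infty Om f -> (S f <-> forall n, U n f).

Fixpoint Cpartial (u : nat -> Cpx) (n : nat) : Cpx :=
  match n with O => u O | S k => Cadd (Cpartial u k) (u (S k)) end.

Definition Cseries_cv (u : nat -> Cpx) (l : Cpx) : Prop :=
  forall eps, 0 < eps -> exists N, forall n, (n >= N)%nat ->
    Cnorm (Csub (Cpartial u n) l) < eps.

Definition real_analytic_at_on_curve (g : Cpx -> Cpx) (gamma : R -> Cpx) (t0 : R) : Prop :=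
  exists (a : nat -> Cpx) (delta : R), 0 < delta /\
    forall t, t0 - delta < t < t0 + delta ->
      Cseries_cv (fun n => Cmul (a n) (Cpow (RtoC (t - t0)) n)) (g (gamma t)).

Definition nowhere_RA_on_boundary (Om : Cpx -> Prop) (m : nat) (Phi : nat -> Cpx -> Cpx)
  (f : Cpx -> Cpx) : Prop :=
  forall F, continuous_on (closure Om) F -> (forall z, Om z -> F z = f z) ->
    forall j, (j < m)%nat -> forall t0, ~ real_analytic_at_on_curve F (curve (Phi j)) t0.

(* Main.v *)
From Coquelicot Require Import Coquelicot.
From Stdlib Require Import Reals ZArith Arith.Factorial Arith.Cantor Lra Lia.
From Stdlib Require Import FunctionalExtensionality IndefiniteDescription Classical.
Require Import Defs.
Open Scope R_scope.

(** A function h of a real variable is analytic somewhere iff, for some q in a fixed countable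
    dense set and some K, its expansion at q satisfies |h(q+y) - P_n(y)| <= K^(n+1) |y|^n for all n
    and all |y| < 1/K, where P_n is the n-th partial sum. For fixed (q, K) this condition is closed
    under uniform convergence, which gives the G_delta property. Density is Baire's theorem, carried
    out by hand on the towers of extended derivatives, once the condition is known to have empty
    interior. Take q with gamma'(q) = T <> 0 and poles w = gamma(q) +- d i T: adding to f the
    function c/(z-w) with c of order d^(N+1) is a small perturbation for the seminorms of order
    <= N, but the differences of order N+1 at scale d of c/(gamma-w) are of order d^N, whereas the
    condition would make them O(d^(N+1)).

    The poles must stay at distance comparable to d from the closure of Omega. If this failed for
    both signs, Omega would contain points on both sides of gamma; as Omega is connected and misses
    gamma, (gamma - w+)(gamma - w-) would have a continuous periodic square root up to a positive
    factor, which is impossible because the argument of (gamma - w+)/(gamma - w-) crosses the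
    negative axis exactly once. *)

(** * Uniform Taylor bounds and real analyticity *)

(** Differences over the dilates y, 2y, 4y, ... fit a blow-up at scale d, because they commute with
    y |-> dy. The difference at d of the added pole is thus, up to a factor, the difference at 1 of
    x |-> d / (gamma(q + dx) - w), which is read only at x = 1, 2, ..., 2^(N+1). Differentiability
    of gamma at q gives convergence at these points to 1 / (T(x - i)) or 1 / (T(x + i)), and the
    difference of this limit has a closed form that is visibly nonzero. The tangent may vanish at a
    point of the countable dense set, so each centre is moved to a nearby parameter with nonzero
    tangent. The side on which the poles are exterior could alternate as d shrinks; one sign that
    works for arbitrarily small d is enough, since the contradiction takes a single small d. The
    parity of the winding number is expressed by a periodic square root, so that only the
    intermediate value theorem is required to compare the two sides of a curve. *)

Fixpoint psum (a : nat -> R) (n : nat) (y : R) : R :=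
  match n with O => 0 | S k => psum a k y + a k * y ^ k end.

(** One constant is both inverse radius and growth rate: K^(n+1) |y|^n = K (K|y|)^n tends to 0 for
    |y| < 1/K, so the bounds alone make the series with coefficients [a] converge to h. *)
Definition taylor_bound (q K : R) (h : R -> R) : Prop :=
  exists a : nat -> R, forall n y, Rabs y < / K ->
    Rabs (h (q + y) - psum a n y) <= K ^ S n * Rabs y ^ n.

(* Built from v(2y) - 2^k v(y), k < l, each of which annihilates the monomial y^k. *)
Fixpoint dil_diff (l : nat) (v : R -> R) (y : R) : R :=
  match l with
  | O => v y
  | S k => dil_diff k v (2 * y) - 2 ^ k * dil_diff k v y
  end.

(** Bound for [dil_diff l] in the supremum norm: the k-th factor v(2y) - 2^k v(y) contributes 1 +
    2^k. *)
Fixpoint dil_const (l : nat) : R :=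
  match l with O => 1 | S k => (1 + 2 ^ k) * dil_const k end.

Lemma psum_ext a b n y : (forall k, (k < n)%nat -> a k = b k) -> psum a n y = psum b n y.
Proof.
  induction n as [|n IH]; intros H; simpl; [easy|].
  rewrite IH; [rewrite (H n); [easy|lia]|]. intros k Hk; apply H; lia.
Qed.

Lemma psum_minus a b n y : psum (fun k => a k - b k) n y = psum a n y - psum b n y.
Proof. induction n as [|n IH]; simpl; [lra|]. rewrite IH; ring. Qed.

Lemma psum_double c n y :
  psum c (S n) (2 * y) - 2 ^ n * psum c (S n) y = psum (fun k => (2 ^ k - 2 ^ n) * c k) n y.
Proof.
  enough (H : forall m, psum c m (2 * y) - 2 ^ n * psum c m y =
                   psum (fun k => (2 ^ k - 2 ^ n) * c k) m y).
  { rewrite H. simpl. ring. }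
  induction m as [|m IH]; simpl; [ring|]. rewrite <- IH, Rpow_mult_distr. ring.
Qed.

Lemma psum_abs_le c n rho M : 0 <= rho ->
  (forall k, (k < n)%nat -> Rabs (c k) * rho ^ k <= M) -> Rabs (psum c n rho) <= INR n * M.
Proof.
  intros Hr. induction n as [|n IH]; intros H.
  - simpl. rewrite Rabs_R0. lra.
  - rewrite S_INR. simpl psum.
    eapply Rle_trans; [apply Rabs_triang|].
    rewrite Rabs_mult, (Rabs_pos_eq (rho ^ n)) by now apply pow_le.
    assert (H1 := H n (Nat.lt_succ_diag_r n)).
    assert (H2 : Rabs (psum c n rho) <= INR n * M) by (apply IH; intros; apply H; lia).
    lra.
Qed.

Lemma pow2_gap k n : (k < n)%nat -> 1 <= Rabs (2 ^ k - 2 ^ n).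
Proof.
  intros H. rewrite Rabs_minus_sym, Rabs_pos_eq.
  - assert (H1 : 2 ^ S k <= 2 ^ n) by (apply Rle_pow; [lra|lia]).
    assert (H2 : 1 <= 2 ^ k) by (apply pow_R1_Rle; lra).
    simpl in H1. lra.
  - assert (2 ^ k <= 2 ^ n) by (apply Rle_pow; [lra|lia]). lra.
Qed.

(* p(2y) - 2^n p(y) loses the monomial of degree n: induction on the degree. *)
Lemma coef_bound n : exists B, 0 <= B /\ forall c rho M, 0 < rho ->
  (forall y, Rabs y <= rho -> Rabs (psum c n y) <= M) ->
  forall k, (k < n)%nat -> Rabs (c k) * rho ^ k <= B * M.
Proof.
  induction n as [|n [B [HB IH]]].
  { exists 0. split; [lra|]. intros; lia. }
  (* [psum_double] reads the polynomial at 2y, so the induction hypothesis is used on radius rho/2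
     with bound (1 + 2^n) M; returning to rho costs 2^k, at most 2^n. *)
  set (B' := 2 ^ n * (B * (1 + 2 ^ n))).
  assert (Hp : 1 <= 2 ^ n) by (apply pow_R1_Rle; lra).
  assert (HB' : 0 <= B') by (unfold B'; repeat apply Rmult_le_pos; lra).
  exists (B' + 1 + INR n * B'). split.
  { assert (0 <= INR n * B') by (apply Rmult_le_pos; [apply pos_INR|easy]). lra. }
  intros c rho M Hrho HM.
  assert (HM0 : 0 <= M).
  { eapply Rle_trans; [apply Rabs_pos|apply (HM 0)]. rewrite Rabs_R0; lra. }
  assert (Hlow : forall k, (k < n)%nat -> Rabs (c k) * rho ^ k <= B' * M).
  { intros k Hk.
    assert (H : Rabs ((2 ^ k - 2 ^ n) * c k) * (rho / 2) ^ k <= B * ((1 + 2 ^ n) * M)).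
    { apply (IH (fun k => (2 ^ k - 2 ^ n) * c k)); [lra| |easy].
      intros y Hy. rewrite <- psum_double.
      eapply Rle_trans; [apply Rabs_triang|].
      rewrite Rabs_Ropp, Rabs_mult, (Rabs_pos_eq (2 ^ n)) by lra.
      assert (H1 : Rabs (psum c (S n) (2 * y)) <= M).
      { apply HM. rewrite Rabs_mult, (Rabs_pos_eq 2) by lra. lra. }
      assert (H2 : Rabs (psum c (S n) y) <= M) by (apply HM; lra).
      assert (2 ^ n * Rabs (psum c (S n) y) <= 2 ^ n * M) by (apply Rmult_le_compat_l; lra).
      lra. }
    unfold Rdiv in H. rewrite Rabs_mult, Rpow_mult_distr in H.
    assert (Hk2 : 2 ^ k <= 2 ^ n) by (apply Rle_pow; [lra|lia]).
    assert (Hk0 : 0 < 2 ^ k) by (apply pow_lt; lra).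
    assert (Hg := pow2_gap k n Hk).
    assert (Hr : 0 < rho ^ k) by now apply pow_lt.
    assert (E : Rabs (c k) * rho ^ k <= 2 ^ k * (Rabs (2 ^ k - 2 ^ n) * Rabs (c k) * (rho ^ k * (/ 2) ^ k))).
    { replace (2 ^ k * (Rabs (2 ^ k - 2 ^ n) * Rabs (c k) * (rho ^ k * (/ 2) ^ k)))
        with (Rabs (2 ^ k - 2 ^ n) * (Rabs (c k) * rho ^ k)).
      2:{ rewrite pow_inv. field. lra. }
      rewrite <- (Rmult_1_l (Rabs (c k) * rho ^ k)) at 1.
      apply Rmult_le_compat_r; [|easy].
      apply Rmult_le_pos; [apply Rabs_pos|lra]. }
    eapply Rle_trans; [exact E|].
    replace (B' * M) with (2 ^ n * (B * ((1 + 2 ^ n) * M))) by (unfold B'; ring).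
    apply Rmult_le_compat; [lra| |easy|easy].
    repeat apply Rmult_le_pos; try apply Rabs_pos; try lra. apply pow_le; lra. }
  assert (HnB : 0 <= INR n * (B' * M)).
  { apply Rmult_le_pos; [apply pos_INR|now apply Rmult_le_pos]. }
  assert (HBM : 0 <= B' * M) by now apply Rmult_le_pos.
  intros k Hk. destruct (Nat.eq_dec k n) as [->|Hne].
  (* The top monomial at y = rho is the whole sum minus its n lower terms, each already bounded by
     B' M. *)
  - assert (H1 : Rabs (psum c (S n) rho) <= M) by (apply HM; rewrite Rabs_pos_eq; lra).
    assert (H2 := psum_abs_le c n rho _ (Rlt_le _ _ Hrho) Hlow).
    assert (H3 : Rabs (c n) * rho ^ n <= Rabs (psum c (S n) rho) + Rabs (psum c n rho)).
    { rewrite <- (Rabs_pos_eq (rho ^ n)) by (apply pow_le; lra).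
      rewrite <- Rabs_mult.
      replace (c n * rho ^ n) with (psum c (S n) rho + - psum c n rho) by (simpl; ring).
      rewrite <- (Rabs_Ropp (psum c n rho)). apply Rabs_triang. }
    lra.
  - assert (H := Hlow k ltac:(lia)). lra.
Qed.

Lemma is_lim_seq_psum (a : nat -> nat -> R) (b : nat -> R) n y :
  (forall k, is_lim_seq (fun i => a i k) (b k)) ->
  is_lim_seq (fun i => psum (a i) n y) (psum b n y).
Proof.
  intros H. induction n as [|n IH]; simpl.
  - apply is_lim_seq_const.
  - apply is_lim_seq_plus'; [easy|].
    apply (is_lim_seq_scal_r _ (y ^ n) (b n)), H.
Qed.

Lemma is_lim_seq_inv_S : is_lim_seq (fun i => / INR (S i)) 0.
Proof.
  apply (is_lim_seq_incr_1 (fun i => / INR i)).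
  change (Finite 0) with (Rbar_inv p_infty).
  apply is_lim_seq_inv; [apply is_lim_seq_INR | easy].
Qed.

(** The point is that the coefficients of the approximants converge. Two partial sums up to degree m
    differ on |y| <= rho by O(rho^(m+1)) plus the approximation errors, so by [coef_bound] their
    m-th coefficients differ by O(rho) + O(e / rho^m). The limits of the coefficients then inherit
    the bounds. *)
Lemma taylor_bound_closed q K h : 0 < K ->
  (forall eps, 0 < eps -> exists h', taylor_bound q K h' /\
     forall y, Rabs y < / K -> Rabs (h (q + y) - h' (q + y)) <= eps) ->
  taylor_bound q K h.
Proof.
  intros HK H.
  assert (HKi := Rinv_0_lt_compat _ HK).
  assert (H' : forall i : nat, exists a : nat -> R, forall n y, Rabs y < / K ->
     Rabs (h (q + y) - psum a n y) <= K ^ S n * Rabs y ^ n + / INR (S i)).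
  { intros i. destruct (H (/ INR (S i))) as [h' [[a Ha] Hh]].
    { apply Rinv_0_lt_compat, lt_0_INR. lia. }
    exists a. intros n y Hy. specialize (Ha n y Hy). specialize (Hh y Hy).
    replace (h (q + y) - psum a n y) with
      ((h' (q + y) - psum a n y) + (h (q + y) - h' (q + y))) by ring.
    eapply Rle_trans; [apply Rabs_triang|]. lra. }
  apply functional_choice in H'. destruct H' as [a Ha].
  assert (Hc : forall m, Cauchy_crit (fun i => a i m)).
  { intros m eta Heta.
    destruct (coef_bound (S m)) as [B [HB HBd]].
    set (D := B * (2 * K ^ S (S m)) + 1).
    assert (HD : 0 < D).
    { assert (0 <= B * (2 * K ^ S (S m))).
      { apply Rmult_le_pos; [easy|]. assert (0 < K ^ S (S m)) by now apply pow_lt. lra. }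
      unfold D; lra. }
    (* Small enough for the Taylor remainders to contribute at most eta/4; the approximation error e
       is fixed afterwards, in terms of rho^m. *)
    set (rho := Rmin (/ K / 2) (eta / 4 / D)).
    assert (Hrho : 0 < rho) by (apply Rmin_glb_lt; repeat apply Rdiv_lt_0_compat; lra).
    assert (Hrho1 : rho <= / K / 2) by apply Rmin_l.
    assert (Hrho2 : rho <= eta / 4 / D) by apply Rmin_r.
    assert (Hrm : 0 < rho ^ m) by now apply pow_lt.
    set (e := eta * rho ^ m / 8 / (B + 1)).
    assert (He : 0 < e).
    { unfold e. repeat apply Rdiv_lt_0_compat; try lra. now apply Rmult_lt_0_compat. }
    destruct (proj2 (is_lim_seq_spec _ _) is_lim_seq_inv_S (mkposreal e He)) as [N HN].
    change (forall n, (N <= n)%nat -> Rabs (/ INR (S n) - 0) < e) in HN. exists N. intros i i' Hi Hi'. unfold Rdist.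
    assert (Hei := HN i Hi). assert (Hei' := HN i' Hi').
    rewrite Rminus_0_r in Hei, Hei'. apply Rabs_lt_between in Hei. apply Rabs_lt_between in Hei'.
    assert (Hb : Rabs (a i m - a i' m) * rho ^ m <=
       B * (2 * K ^ S (S m) * rho ^ S m + 2 * e)).
    { apply (HBd (fun k => a i k - a i' k) rho); [easy| |lia].
      intros y Hy. rewrite psum_minus.
      assert (Hy' : Rabs y < / K) by lra.
      assert (H1 := Ha i (S m) y Hy'). assert (H2 := Ha i' (S m) y Hy').
      replace (psum (a i) (S m) y - psum (a i') (S m) y) with
        (- (h (q + y) - psum (a i) (S m) y) + (h (q + y) - psum (a i') (S m) y)) by ring.
      eapply Rle_trans; [apply Rabs_triang|]. rewrite Rabs_Ropp.
      assert (H3 : K ^ S (S m) * Rabs y ^ S m <= K ^ S (S m) * rho ^ S m).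
      { apply Rmult_le_compat_l; [apply pow_le; lra|].
        apply pow_incr; split; [apply Rabs_pos|easy]. }
      lra. }
    apply Rmult_lt_reg_r with (rho ^ m); [easy|].
    eapply Rle_lt_trans; [exact Hb|].
    replace (B * (2 * K ^ S (S m) * rho ^ S m + 2 * e)) with
      (B * (2 * K ^ S (S m)) * rho * rho ^ m + 2 * B * e) by (simpl; ring).
    assert (H1 : B * (2 * K ^ S (S m)) * rho <= eta / 4).
    { apply Rle_trans with (D * rho).
      - apply Rmult_le_compat_r; [lra|]. unfold D; lra.
      - apply Rle_trans with (D * (eta / 4 / D)); [apply Rmult_le_compat_l; lra|].
        right. field. lra. }
    assert (H2 : 2 * B * e <= eta / 4 * rho ^ m).
    { apply Rle_trans with (2 * (B + 1) * e); [apply Rmult_le_compat_r; lra|].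
      unfold e. right. field. lra. }
    assert (H3 : B * (2 * K ^ S (S m)) * rho * rho ^ m <= eta / 4 * rho ^ m)
      by (apply Rmult_le_compat_r; lra).
    assert (0 < eta * rho ^ m) by now apply Rmult_lt_0_compat. lra. }
  assert (Hlim : forall m, exists b : R, is_lim_seq (fun i => a i m) b).
  { intros m. destruct (R_complete _ (Hc m)) as [b Hb]. exists b.
    now apply is_lim_seq_Reals. }
  apply functional_choice in Hlim. destruct Hlim as [b Hb].
  exists b. intros n y Hy.
  assert (L1 : is_lim_seq (fun i => Rabs (h (q + y) - psum (a i) n y))
                 (Rabs (h (q + y) - psum b n y))).
  { apply (is_lim_seq_abs _ (Finite _)).
    apply is_lim_seq_minus'; [apply is_lim_seq_const|apply is_lim_seq_psum; intros k; apply Hb]. }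
  assert (L2 : is_lim_seq (fun i => K ^ S n * Rabs y ^ n + / INR (S i)) (K ^ S n * Rabs y ^ n + 0)).
  { apply is_lim_seq_plus'; [apply is_lim_seq_const|apply is_lim_seq_inv_S]. }
  rewrite Rplus_0_r in L2.
  apply (is_lim_seq_le _ _ _ _ (fun i => Ha i n y Hy) L1 L2).
Qed.

(** The coefficient of y^m in (d + y)^k, that is binom(k, m) d^(k-m), by Pascal's rule and without
    truncated subtraction. *)
Fixpoint bin_coef (d : R) (k m : nat) : R :=
  match k, m with
  | O, O => 1
  | O, S _ => 0
  | S k', O => d * bin_coef d k' O
  | S k', S m' => d * bin_coef d k' (S m') + bin_coef d k' m'
  end.

Lemma psum_bin_coef_S d k n y :
  psum (bin_coef d (S k)) (S n) y = d * psum (bin_coef d k) (S n) y + y * psum (bin_coef d k) n y.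
Proof.
  induction n as [|n IH].
  - simpl. ring.
  - change (psum (bin_coef d (S k)) (S (S n)) y) with
      (psum (bin_coef d (S k)) (S n) y + bin_coef d (S k) (S n) * y ^ S n).
    rewrite IH. simpl. ring.
Qed.

(** For m >= n and |y| <= s one has |y|^m <= (|y|/s)^n s^m, so the tail of the binomial expansion is
    at most (|y|/s)^n times the full expansion of (|d| + s)^k. *)
Lemma bin_coef_remainder d s k n y : 0 < s -> Rabs y <= s ->
  Rabs ((d + y) ^ k - psum (bin_coef d k) n y) <= Rabs y ^ n * (/ s) ^ n * (Rabs d + s) ^ k.
Proof.
  intros Hs Hy. assert (Hd := Rabs_pos d). assert (Hy0 := Rabs_pos y).
  assert (Hsi := Rinv_0_lt_compat _ Hs).
  revert n. induction k as [|k IH]; intros [|n].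
  - simpl. rewrite Rminus_0_r, Rabs_R1. lra.
  - assert (E : psum (bin_coef d 0) (S n) y = 1).
    { clear. induction n as [|n IH]; [simpl; ring|].
      change (psum (bin_coef d 0) (S n) y + 0 * y ^ S n = 1). rewrite IH. ring. }
    rewrite E. simpl pow at 1. rewrite Rminus_diag, Rabs_R0.
    apply Rmult_le_pos; [apply Rmult_le_pos; apply pow_le; lra|simpl; lra].
  - simpl psum. rewrite Rminus_0_r, <- RPow_abs.
    rewrite !pow_O, !Rmult_1_l. apply pow_incr. split; [apply Rabs_pos|].
    eapply Rle_trans; [apply Rabs_triang|]. lra.
  - rewrite psum_bin_coef_S.
    replace ((d + y) ^ S k - (d * psum (bin_coef d k) (S n) y + y * psum (bin_coef d k) n y))
      with (d * ((d + y) ^ k - psum (bin_coef d k) (S n) y) +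
            y * ((d + y) ^ k - psum (bin_coef d k) n y)) by (simpl; ring).
    eapply Rle_trans; [apply Rabs_triang|]. rewrite !Rabs_mult.
    apply Rle_trans with
      (Rabs d * (Rabs y ^ S n * (/ s) ^ S n * (Rabs d + s) ^ k) +
       Rabs y * (Rabs y ^ n * (/ s) ^ n * (Rabs d + s) ^ k)).
    + apply Rplus_le_compat; (apply Rmult_le_compat_l; [lra|apply IH]).
    + right. simpl. field. lra.
Qed.

(** Times s^m, the left side is a single term of the expansion of (|d| + s)^k. *)
Lemma bin_coef_abs d s k m : 0 < s -> Rabs (bin_coef d k m) <= (/ s) ^ m * (Rabs d + s) ^ k.
Proof.
  intros Hs. assert (Hd := Rabs_pos d). assert (Hsi := Rinv_0_lt_compat _ Hs).
  revert m. induction k as [|k IH]; intros [|m]; simpl.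
  - rewrite Rabs_R1; lra.
  - rewrite Rabs_R0. rewrite Rmult_1_r. apply Rmult_le_pos; [lra|apply pow_le; lra].
  - rewrite Rabs_mult. specialize (IH 0%nat). simpl in IH.
    rewrite Rmult_1_l in IH |- *. apply Rmult_le_compat; try apply Rabs_pos; lra.
  - eapply Rle_trans; [apply Rabs_triang|]. rewrite Rabs_mult.
    apply Rle_trans with (Rabs d * ((/ s) ^ S m * (Rabs d + s) ^ k) + (/ s) ^ m * (Rabs d + s) ^ k).
    + apply Rplus_le_compat; [apply Rmult_le_compat_l; [lra|]|]; apply IH.
    + right. simpl. field. lra.
Qed.

Lemma is_series_mult_l (c : R) (b : nat -> R) (l : R) :
  is_series b l -> is_series (fun k => c * b k) (c * l).
Proof. intros H. exact (is_series_scal (K := R_AbsRing) (V := R_NormedModule) c b l H). Qed.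

Lemma is_series_geom_bound (b : nat -> R) l M th : 0 <= th < 1 ->
  (forall k, Rabs (b k) <= M * th ^ k) -> is_series b l -> Rabs l <= M / (1 - th).
Proof.
  intros Hth Hb Hs.
  assert (Hg : is_series (fun k => M * th ^ k) (M / (1 - th))).
  { apply is_series_mult_l, is_series_geom. rewrite Rabs_pos_eq; lra. }
  rewrite <- (is_series_unique _ _ Hs), <- (is_series_unique _ _ Hg).
  assert (Ha : ex_series (fun k => Rabs (b k))).
  { apply (ex_series_le (K := R_AbsRing) (V := R_CompleteNormedModule) _ (fun k => M * th ^ k)).
    - intros k. unfold norm; simpl. unfold abs; simpl. rewrite Rabs_Rabsolu. apply Hb.
    - now exists (M / (1 - th)). }
  eapply Rle_trans; [now apply Series_Rabs|].
  apply Series_le; [|now exists (M / (1 - th))].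
  intros k. split; [apply Rabs_pos|apply Hb].
Qed.

Lemma ex_series_geom_bound (b : nat -> R) M th : 0 <= th < 1 ->
  (forall k, Rabs (b k) <= M * th ^ k) -> ex_series b.
Proof.
  intros Hth Hb.
  apply (ex_series_le (K := R_AbsRing) (V := R_CompleteNormedModule) _ (fun k => M * th ^ k)); [exact Hb|].
  exists (M * / (1 - th)).
  apply is_series_mult_l, is_series_geom. rewrite Rabs_pos_eq; lra.
Qed.

Definition power_series_at (h : R -> R) (t0 delta : R) (a : nat -> R) : Prop :=
  forall t, Rabs (t - t0) < delta -> is_series (fun k => a k * (t - t0) ^ k) (h t).

(** Recentring a power series: each (t - t0)^k is expanded at q and [bin_coef_remainder] is summed
    over k. The constant is uniform in q and any larger K is allowed, so that q can be a listed
    centre and K an integer. *)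
Lemma taylor_bound_near h t0 delta a : 0 < delta -> power_series_at h t0 delta a ->
  exists K0, 0 < K0 /\
    forall q, Rabs (q - t0) <= delta / 8 -> forall K, K0 <= K -> taylor_bound q K h.
Proof.
  intros Hdelta Ha.
  (* With |q - t0| <= delta/8 this gives |q - t0| + s <= (3/4) rho, while |a_k| rho^k stays bounded;
     hence geometric convergence with ratio 3/4. *)
  set (rho := delta / 2). set (s := delta / 4).
  assert (Hs : 0 < s) by (unfold s; lra).
  assert (Hrho : 0 < rho) by (unfold rho; lra).
  assert (Hbd : exists C, 0 < C /\ forall k, Rabs (a k) * rho ^ k <= C).
  { assert (Hser : is_series (fun k => a k * (t0 + rho - t0) ^ k) (h (t0 + rho))).
    { apply Ha. replace (t0 + rho - t0) with rho by ring. rewrite Rabs_pos_eq; unfold rho; lra. }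
    assert (Hl : is_lim_seq (fun k => a k * (t0 + rho - t0) ^ k) 0).
    { apply ex_series_lim_0. eexists; exact Hser. }
    apply is_lim_seq_Reals in Hl.
    destruct (maj_by_pos _ (exist _ 0 Hl)) as [C [HC0 HC]].
    exists C. split; [easy|]. intros k. specialize (HC k).
    replace (t0 + rho - t0) with rho in HC by ring.
    rewrite Rabs_mult, (Rabs_pos_eq (rho ^ k)) in HC by (apply pow_le; lra). exact HC. }
  destruct Hbd as [C [HC0 HC]].
  (* 1/s bounds the ratio of the remainders, and 4C = C / (1 - 3/4) is the sum of the geometric
     majorant. *)
  exists (Rmax (/ s) (4 * C)).
  assert (Hm1 := Rmax_l (/ s) (4 * C)). assert (Hm2 := Rmax_r (/ s) (4 * C)).
  assert (Hsi := Rinv_0_lt_compat _ Hs).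
  split; [lra|]. intros q Hq K HK.
  set (d := q - t0) in *.
  assert (Hpow : forall k, Rabs (a k) * (Rabs d + s) ^ k <= C * (3 / 4) ^ k).
  { intros k. apply Rle_trans with (Rabs (a k) * ((3 / 4) * rho) ^ k).
    - apply Rmult_le_compat_l; [apply Rabs_pos|]. apply pow_incr.
      split; [assert (Hd := Rabs_pos d); lra|]. unfold rho, s; lra.
    - rewrite Rpow_mult_distr.
      replace (Rabs (a k) * ((3 / 4) ^ k * rho ^ k)) with ((Rabs (a k) * rho ^ k) * (3 / 4) ^ k) by ring.
      apply Rmult_le_compat_r; [apply pow_le; lra|apply HC]. }
  set (A := fun m => Series (fun k => a k * bin_coef d k m)).
  assert (HA : forall m, is_series (fun k => a k * bin_coef d k m) (A m)).
  { intros m. apply Series_correct.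
    apply (ex_series_geom_bound _ ((/ s) ^ m * C) (3 / 4)); [lra|].
    intros k. rewrite Rabs_mult.
    apply Rle_trans with (Rabs (a k) * ((/ s) ^ m * (Rabs d + s) ^ k)).
    - apply Rmult_le_compat_l; [apply Rabs_pos|now apply bin_coef_abs].
    - rewrite Rmult_assoc. rewrite (Rmult_comm (Rabs (a k))), Rmult_assoc.
      apply Rmult_le_compat_l; [apply pow_le; lra|].
      rewrite Rmult_comm. apply Hpow. }
  exists A. intros n y Hy.
  assert (HK0 : 0 < K) by lra.
  assert (HKs : / K <= s).
  { rewrite <- (Rinv_inv s). apply Rinv_le_contravar; lra. }
  assert (Hsum : is_series (fun k => a k * psum (bin_coef d k) n y) (psum A n y)).
  { clear -HA. induction n as [|n IH]; simpl.
    - apply (is_series_ext (fun k => 0 * 0 ^ k)); [intros; simpl; ring|].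
      assert (Z := is_series_mult_l 0 _ _ (is_series_geom 0 ltac:(rewrite Rabs_R0; lra))).
      rewrite Rmult_0_l in Z. exact Z.
    - apply (is_series_ext (fun k => a k * psum (bin_coef d k) n y + y ^ n * (a k * bin_coef d k n))).
      { intros k. simpl. ring. }
      apply (is_series_plus (K := R_AbsRing) (V := R_NormedModule)); [exact IH|].
      rewrite Rmult_comm. apply is_series_mult_l, HA. }
  assert (Hh : is_series (fun k => a k * (d + y) ^ k) (h (q + y))).
  { apply (is_series_ext (fun k => a k * (q + y - t0) ^ k)).
    { intros k. do 2 f_equal. unfold d; ring. }
    apply Ha. replace (q + y - t0) with (d + y) by (unfold d; ring).
    eapply Rle_lt_trans; [apply Rabs_triang|]. unfold s in *. lra. }
  assert (Hdiff := is_series_minus (K := R_AbsRing) (V := R_NormedModule) _ _ _ _ Hh Hsum).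
  apply (is_series_geom_bound _ _ (Rabs y ^ n * (/ s) ^ n * C) (3 / 4)) in Hdiff; [|lra|].
  - eapply Rle_trans; [exact Hdiff|].
    replace (Rabs y ^ n * (/ s) ^ n * C / (1 - 3 / 4)) with ((4 * C * (/ s) ^ n) * Rabs y ^ n) by field.
    apply Rmult_le_compat_r; [apply pow_le, Rabs_pos|].
    simpl. apply Rmult_le_compat; [lra|apply pow_le; lra|lra|]. apply pow_incr; lra.
  - intros k. unfold plus, opp; simpl.
    replace (a k * (d + y) ^ k + - (a k * psum (bin_coef d k) n y)) with
      (a k * ((d + y) ^ k - psum (bin_coef d k) n y)) by ring.
    rewrite Rabs_mult.
    apply Rle_trans with (Rabs (a k) * (Rabs y ^ n * (/ s) ^ n * (Rabs d + s) ^ k)).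
    + apply Rmult_le_compat_l; [apply Rabs_pos|]. apply bin_coef_remainder; lra.
    + replace (Rabs (a k) * (Rabs y ^ n * (/ s) ^ n * (Rabs d + s) ^ k)) with
        (Rabs y ^ n * (/ s) ^ n * (Rabs (a k) * (Rabs d + s) ^ k)) by ring.
      rewrite (Rmult_assoc _ C).
      apply Rmult_le_compat_l; [|apply Hpow].
      apply Rmult_le_pos; apply pow_le; [apply Rabs_pos|lra].
Qed.

Lemma taylor_bound_series q K h : 0 < K -> taylor_bound q K h ->
  exists a, power_series_at h q (/ K) a.
Proof.
  intros HK [a Ha]. exists a. intros t Ht.
  set (y := t - q) in *. replace t with (q + y) by (unfold y; ring).
  assert (E : forall n, sum_n (fun k => a k * y ^ k) n = psum a (S n) y).
  { induction n as [|n IH]; [rewrite sum_O; simpl; ring|].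
    rewrite sum_Sn, IH. reflexivity. }
  assert (Hth : Rabs (K * Rabs y) < 1).
  { rewrite Rabs_mult, Rabs_Rabsolu, (Rabs_pos_eq K) by lra.
    apply Rmult_lt_reg_l with (/ K); [now apply Rinv_0_lt_compat|].
    rewrite <- Rmult_assoc, Rinv_l by lra. lra. }
  assert (L : is_lim_seq (fun n => h (q + y) - sum_n (fun k => a k * y ^ k) n) 0).
  { apply is_lim_seq_abs_0.
    apply (is_lim_seq_le_le (fun _ => 0) _ (fun n => (K * (K * Rabs y)) * (K * Rabs y) ^ n)).
    - intros n. split; [apply Rabs_pos|]. rewrite E.
      eapply Rle_trans; [now apply Ha|]. right. rewrite Rpow_mult_distr. simpl. ring.
    - apply is_lim_seq_const.
    - replace (Finite 0) with (Rbar_mult (K * (K * Rabs y)) 0) by (simpl; now rewrite Rmult_0_r).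
      apply is_lim_seq_scal_l, is_lim_seq_geom, Hth. }
  assert (L' : is_lim_seq (sum_n (fun k => a k * y ^ k)) (h (q + y) - 0)).
  { apply (is_lim_seq_ext (fun n => h (q + y) - (h (q + y) - sum_n (fun k => a k * y ^ k) n))).
    { intros n; ring. }
    apply is_lim_seq_minus'; [apply is_lim_seq_const|exact L]. }
  rewrite Rminus_0_r in L'. exact L'.
Qed.

Lemma dil_diff_plus l f g y :
  dil_diff l (fun x => f x + g x) y = dil_diff l f y + dil_diff l g y.
Proof. revert y. induction l as [|l IH]; intros y; simpl; [easy|]. rewrite !IH; ring. Qed.

Lemma dil_diff_ext l f g y : (forall x, f x = g x) -> dil_diff l f y = dil_diff l g y.
Proof. intros H. revert y. induction l as [|l IH]; intros y; simpl; [easy|]. now rewrite !IH. Qed.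

(** The operator is diagonal on monomials: y^k is multiplied by the product of 2^k - 2^j over j < l,
    which vanishes for k < l. The induction is stated for longer polynomials, since the number of
    factors grows while the length must stay fixed. *)
Lemma dil_diff_psum l : forall c y, dil_diff l (psum c l) y = 0.
Proof.
  enough (H : forall m n c, exists c', forall y, dil_diff m (psum c (m + n)) y =
    psum (fun k => c' k * c k) (m + n) y /\ forall k, (k < m)%nat -> c' k = 0).
  { intros c y. destruct (H l O c) as [c' Hc']. rewrite Nat.add_0_r in Hc'.
    destruct (Hc' y) as [E Hz]. rewrite E.
    enough (Z : forall p, (p <= l)%nat -> psum (fun k => c' k * c k) p y = 0) by now apply Z.
    induction p as [|p IHp]; intros Hp; simpl; [easy|].
    rewrite IHp by lia. rewrite Hz by lia. ring. }
  induction m as [|m IH]; intros n c.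
  - exists (fun _ => 1). intros y. split; [|intros; lia].
    apply psum_ext. intros; ring.
  - destruct (IH (S n) c) as [c' Hc']. rewrite Nat.add_succ_r in Hc'.
    exists (fun k => (2 ^ k - 2 ^ m) * c' k). intros y. split.
    + change (dil_diff m (psum c (S (m + n))) (2 * y) - 2 ^ m * dil_diff m (psum c (S (m + n))) y
        = psum (fun k => (2 ^ k - 2 ^ m) * c' k * c k) (S (m + n)) y).
      rewrite (proj1 (Hc' (2 * y))), (proj1 (Hc' y)).
      generalize (S (m + n)). intros N. clear. induction N as [|N IHN]; simpl; [ring|].
      rewrite <- IHN, Rpow_mult_distr. ring.
    + intros k Hk. destruct (Nat.eq_dec k m) as [->|Hne]; [ring|].
      rewrite (proj2 (Hc' y)) by lia. ring.
Qed.

Lemma dil_diff_bound l v M : forall y, (forall x, Rabs x <= 2 ^ l * Rabs y -> Rabs (v x) <= M) ->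
  Rabs (dil_diff l v y) <= dil_const l * M.
Proof.
  induction l as [|l IH]; intros y H; simpl.
  - rewrite Rmult_1_l. apply H. simpl. lra.
  - assert (Hp : 0 < 2 ^ l) by (apply pow_lt; lra).
    assert (Hy := Rabs_pos y).
    assert (H0 : 0 <= 2 ^ l * Rabs y) by (apply Rmult_le_pos; lra).
    assert (H1 : Rabs (dil_diff l v (2 * y)) <= dil_const l * M).
    { apply IH. intros x Hx. apply H. rewrite Rabs_mult, (Rabs_pos_eq 2) in Hx by lra. simpl; lra. }
    assert (H2 : Rabs (dil_diff l v y) <= dil_const l * M).
    { apply IH. intros x Hx. apply H. simpl. lra. }
    eapply Rle_trans; [apply Rabs_triang|].
    rewrite Rabs_Ropp, Rabs_mult, (Rabs_pos_eq (2 ^ l)) by lra.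
    assert (2 ^ l * Rabs (dil_diff l v y) <= 2 ^ l * (dil_const l * M)) by (apply Rmult_le_compat_l; lra).
    lra.
Qed.

Lemma dil_const_pos l : 0 < dil_const l.
Proof.
  induction l as [|l IH]; simpl; [lra|].
  apply Rmult_lt_0_compat; [|easy]. assert (0 < 2 ^ l) by (apply pow_lt; lra). lra.
Qed.

(** Both Taylor polynomials have degree below l and are annihilated; only the two remainders
    survive, each at most K^(l+1) (2^l |y|)^l at the points where the difference is evaluated. *)
Lemma taylor_bound_dil_diff q K l h1 h2 y : 0 < K ->
  taylor_bound q K h1 -> taylor_bound q K h2 -> 2 ^ l * Rabs y < / K ->
  Rabs (dil_diff l (fun x => h2 (q + x) - h1 (q + x)) y) <=
    dil_const l * (2 * K ^ S l * (2 ^ l) ^ l) * Rabs y ^ l.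
Proof.
  intros HK [a Ha] [b Hb] Hy.
  set (P := psum (fun k => b k - a k) l).
  rewrite (dil_diff_ext _ _ (fun x => P x + (h2 (q + x) - h1 (q + x) - P x))) by (intros; ring).
  rewrite dil_diff_plus. unfold P at 1. rewrite dil_diff_psum, Rplus_0_l.
  rewrite Rmult_assoc, (Rmult_assoc (2 * K ^ S l)), <- Rpow_mult_distr.
  apply dil_diff_bound. intros x Hx. unfold P. rewrite psum_minus.
  assert (Hx' : Rabs x < / K) by lra.
  specialize (Ha l x Hx'). specialize (Hb l x Hx').
  replace (h2 (q + x) - h1 (q + x) - (psum b l x - psum a l x)) with
    ((h2 (q + x) - psum b l x) + - (h1 (q + x) - psum a l x)) by ring.
  eapply Rle_trans; [apply Rabs_triang|]. rewrite Rabs_Ropp.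
  assert (K ^ S l * Rabs x ^ l <= K ^ S l * (2 ^ l * Rabs y) ^ l).
  { apply Rmult_le_compat_l; [apply pow_le; lra|]. apply pow_incr. split; [apply Rabs_pos|easy]. }
  lra.
Qed.

Notation C := Complex.C.
Notation RtoC := Complex.RtoC.

(** * Complex derivatives and towers of derivatives *)

Lemma Cnorm_Cmod : Cnorm = Cmod.
Proof.
  apply functional_extensionality. intros z. unfold Cnorm, Cmod. f_equal. simpl. ring.
Qed.

(** The operations of the statement are convertible to those of the complex library; only the norm
    needs a rewrite, its squares being written as products. *)
Ltac toC :=
  rewrite ?Cnorm_Cmod in *; change Cadd with Cplus in *; change Csub with Cminus in *;
  change Cmul with Cmult in *; change Defs.RtoC with RtoC in *; change Cpx with C in *.

Lemma Cmod_minus_sym (a b : C) : Cmod (a - b) = Cmod (b - a).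
Proof. rewrite <- Cmod_opp. f_equal. ring. Qed.

Lemma Cmod_minus_triangle (a b c : C) : Cmod (a - c) <= Cmod (a - b) + Cmod (b - c).
Proof. replace (a - c)%C with ((a - b) + (b - c))%C by ring. apply Cmod_triangle. Qed.

Lemma Cmod_triangle_inv (a b : C) : Cmod a - Cmod b <= Cmod (a - b).
Proof.
  assert (H := Cmod_triangle (a - b) b). replace (a - b + b)%C with a in H by ring. lra.
Qed.

Lemma Cmod_le_abs (z : C) : Cmod z <= Rabs (fst z) + Rabs (snd z).
Proof.
  assert (H1 := Rabs_pos (fst z)). assert (H2 := Rabs_pos (snd z)).
  apply Rsqr_incr_0_var; [|lra].
  unfold Rsqr. replace (Cmod z * Cmod z) with (Cmod z ^ 2) by ring.
  rewrite Cmod2_alt. unfold Re, Im. rewrite <- (pow2_abs (fst z)), <- (pow2_abs (snd z)).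
  assert (0 <= Rabs (fst z) * Rabs (snd z)) by now apply Rmult_le_pos. lra.
Qed.

Lemma fst_le_Cmod (z : C) : Rabs (fst z) <= Cmod z.
Proof. eapply Rle_trans; [apply Rmax_l|apply Rmax_Cmod]. Qed.

Lemma snd_le_Cmod (z : C) : Rabs (snd z) <= Cmod z.
Proof. eapply Rle_trans; [apply Rmax_r|apply Rmax_Cmod]. Qed.

Lemma Cmod_small_eq (a b : C) : (forall eps, 0 < eps -> Cmod (a - b) <= eps) -> a = b.
Proof.
  intros H. assert (E : (a - b)%C = 0%C).
  { apply Cmod_eq_0. apply Rle_antisym; [|apply Cmod_ge_0].
    apply le_epsilon. intros eps Heps. rewrite Rplus_0_l. now apply H. }
  replace a with ((a - b) + b)%C by ring. rewrite E. ring.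
Qed.

Lemma closure_incl Om z : Om z -> closure Om z.
Proof.
  intros H eps Heps. exists z. split; [easy|]. toC.
  replace (z - z)%C with (RtoC 0) by ring. rewrite Cmod_0. lra.
Qed.

Lemma has_cderiv_at_ext_loc f g z L r : 0 < r -> (forall w, Cmod (w - z) < r -> f w = g w) ->
  has_cderiv_at f z L -> has_cderiv_at g z L.
Proof.
  intros Hr Hfg H eps Heps. destruct (H eps Heps) as [d [Hd Hf]].
  exists (Rmin d r). split; [now apply Rmin_glb_lt|]. intros h Hh.
  assert (H1 := Rmin_l d r). assert (H2 := Rmin_r d r).
  rewrite <- !Hfg.
  - apply Hf. lra.
  - toC. replace (z - z)%C with (RtoC 0) by ring. rewrite Cmod_0. lra.
  - toC. replace (z + h - z)%C with h by ring. lra.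
Qed.

Lemma has_cderiv_at_unique f z L1 L2 : has_cderiv_at f z L1 -> has_cderiv_at f z L2 -> L1 = L2.
Proof.
  intros H1 H2. apply Cmod_small_eq. intros eps Heps.
  destruct (H1 (eps / 2) ltac:(lra)) as [d1 [Hd1 Hf1]].
  destruct (H2 (eps / 2) ltac:(lra)) as [d2 [Hd2 Hf2]].
  set (d := Rmin d1 d2 / 2).
  assert (Hm := Rmin_glb_lt _ _ _ Hd1 Hd2).
  assert (Hm1 := Rmin_l d1 d2). assert (Hm2 := Rmin_r d1 d2).
  assert (Hd : Cmod (RtoC d) = d) by (rewrite Cmod_R, Rabs_pos_eq; unfold d; lra).
  toC. specialize (Hf1 (RtoC d)). specialize (Hf2 (RtoC d)). rewrite Hd in Hf1, Hf2.
  specialize (Hf1 ltac:(unfold d; lra)). specialize (Hf2 ltac:(unfold d; lra)).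
  assert (H : Cmod ((L1 - L2) * RtoC d) <= eps * d).
  { replace ((L1 - L2) * RtoC d)%C with
      ((f (z + RtoC d) - f z - L2 * RtoC d) - (f (z + RtoC d) - f z - L1 * RtoC d))%C by ring.
    eapply Rle_trans; [apply Cmod_triangle|]. rewrite Cmod_opp. lra. }
  rewrite Cmod_mult, Hd in H. apply Rmult_le_reg_r with d; [unfold d; lra|easy].
Qed.

Lemma has_cderiv_at_cont f z L : has_cderiv_at f z L -> forall eps, 0 < eps ->
  exists d, 0 < d /\ forall w, Cmod (w - z) < d -> Cmod (f w - f z) < eps.
Proof.
  intros H eps Heps. destruct (H 1 Rlt_0_1) as [d [Hd Hf]].
  assert (HL := Cmod_ge_0 L).
  assert (Hq : 0 < eps / (Cmod L + 2)) by (apply Rdiv_lt_0_compat; lra).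
  exists (Rmin d (eps / (Cmod L + 2))). split; [now apply Rmin_glb_lt|].
  intros w Hw.
  assert (H1 := Rmin_l d (eps / (Cmod L + 2))). assert (H2 := Rmin_r d (eps / (Cmod L + 2))).
  toC. specialize (Hf (w - z)%C ltac:(lra)). replace (z + (w - z))%C with w in Hf by ring.
  replace (f w - f z)%C with ((f w - f z - L * (w - z)) + L * (w - z))%C by ring.
  eapply Rle_lt_trans; [apply Cmod_triangle|]. rewrite Cmod_mult.
  apply Rle_lt_trans with ((Cmod L + 1) * Cmod (w - z)); [lra|].
  apply Rle_lt_trans with ((Cmod L + 1) * (eps / (Cmod L + 2))).
  - apply Rmult_le_compat_l; lra.
  - apply Rmult_lt_reg_r with (Cmod L + 2); [lra|].
    replace ((Cmod L + 1) * (eps / (Cmod L + 2)) * (Cmod L + 2)) with ((Cmod L + 1) * eps) by (field; lra).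
    rewrite (Rmult_comm eps). apply Rmult_lt_compat_r; lra.
Qed.

Lemma has_cderiv_at_plus f g z L M : has_cderiv_at f z L -> has_cderiv_at g z M ->
  has_cderiv_at (fun x => Cplus (f x) (g x)) z (Cplus L M).
Proof.
  intros H1 H2 eps Heps.
  destruct (H1 (eps / 2) ltac:(lra)) as [d1 [Hd1 Hf1]].
  destruct (H2 (eps / 2) ltac:(lra)) as [d2 [Hd2 Hf2]].
  exists (Rmin d1 d2). split; [now apply Rmin_glb_lt|]. intros h Hh.
  assert (Hm1 := Rmin_l d1 d2). assert (Hm2 := Rmin_r d1 d2).
  specialize (Hf1 h ltac:(lra)). specialize (Hf2 h ltac:(lra)). toC.
  replace (f (z + h) + g (z + h) - (f z + g z) - (L + M) * h)%C with
    ((f (z + h) - f z - L * h) + (g (z + h) - g z - M * h))%C by ring.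
  eapply Rle_trans; [apply Cmod_triangle|]. lra.
Qed.

Lemma has_cderiv_at_const c z : has_cderiv_at (fun _ => c) z (RtoC 0).
Proof.
  intros eps Heps. exists 1. split; [lra|]. intros h Hh. toC.
  replace (c - c - RtoC 0 * h)%C with (RtoC 0) by ring. rewrite Cmod_0.
  apply Rmult_le_pos; [lra|apply Cmod_ge_0].
Qed.

Lemma has_cderiv_at_mult f g z L M : has_cderiv_at f z L -> has_cderiv_at g z M ->
  has_cderiv_at (fun x => Cmult (f x) (g x)) z (Cplus (Cmult L (g z)) (Cmult (f z) M)).
Proof.
  intros H1 H2 eps Heps.
  (* A dominates the companion factor in each of the three error terms, including |g(z + h)| <=
     |g(z)| + 1, so each term is at most e A |h|. *)
  set (A := Cmod (f z) + Cmod (g z) + Cmod L + 2).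
  assert (P1 := Cmod_ge_0 (f z)). assert (P2 := Cmod_ge_0 (g z)). assert (P3 := Cmod_ge_0 L).
  assert (HA : 0 < A) by (unfold A; lra).
  set (e := Rmin 1 (eps / 3 / A)).
  assert (He0 : 0 < eps / 3 / A) by (apply Rdiv_lt_0_compat; lra).
  assert (He : 0 < e) by (apply Rmin_glb_lt; lra).
  assert (He1 : e <= 1) by apply Rmin_l. assert (He2 : e <= eps / 3 / A) by apply Rmin_r.
  assert (HeA : e * A <= eps / 3).
  { apply Rle_trans with (eps / 3 / A * A); [apply Rmult_le_compat_r; lra|right; field; lra]. }
  destruct (H1 e He) as [d1 [Hd1 Hf]]. destruct (H2 e He) as [d2 [Hd2 Hg]].
  destruct (has_cderiv_at_cont _ _ _ H2 e He) as [d3 [Hd3 Hc]].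
  exists (Rmin d1 (Rmin d2 d3)). split; [repeat apply Rmin_glb_lt; easy|]. intros h Hh.
  assert (Hm1 := Rmin_l d1 (Rmin d2 d3)). assert (Hm2 := Rmin_r d1 (Rmin d2 d3)).
  assert (Hm3 := Rmin_l d2 d3). assert (Hm4 := Rmin_r d2 d3).
  specialize (Hf h ltac:(lra)). specialize (Hg h ltac:(lra)). toC.
  specialize (Hc (z + h)%C). replace (z + h - z)%C with h in Hc by ring.
  specialize (Hc ltac:(lra)).
  replace (f (z + h) * g (z + h) - f z * g z - (L * g z + f z * M) * h)%C with
    ((f (z + h) - f z - L * h) * g (z + h) + L * (g (z + h) - g z) * h
     + f z * (g (z + h) - g z - M * h))%C by ring.
  assert (Hgz : Cmod (g (z + h)%C) <= A).
  { replace (g (z + h)%C) with ((g (z + h) - g z) + g z)%C by ring.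
    eapply Rle_trans; [apply Cmod_triangle|]. unfold A; lra. }
  assert (Hh0 := Cmod_ge_0 h).
  assert (B1 : Cmod ((f (z + h) - f z - L * h) * g (z + h))%C <= (e * A) * Cmod h).
  { rewrite Cmod_mult. replace (e * A * Cmod h) with (e * Cmod h * A) by ring.
    apply Rmult_le_compat; try apply Cmod_ge_0; easy. }
  assert (B2 : Cmod (L * (g (z + h) - g z) * h)%C <= (e * A) * Cmod h).
  { rewrite !Cmod_mult. apply Rmult_le_compat_r; [easy|].
    rewrite (Rmult_comm e). apply Rmult_le_compat; try apply Cmod_ge_0; [unfold A; lra|lra]. }
  assert (B3 : Cmod (f z * (g (z + h) - g z - M * h))%C <= (e * A) * Cmod h).
  { rewrite Cmod_mult. replace (e * A * Cmod h) with (A * (e * Cmod h)) by ring.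
    apply Rmult_le_compat; try apply Cmod_ge_0; [unfold A; lra|easy]. }
  eapply Rle_trans; [apply Cmod_triangle|].
  eapply Rle_trans; [apply Rplus_le_compat_r, Cmod_triangle|].
  assert (B4 : (e * A) * Cmod h <= eps / 3 * Cmod h) by (apply Rmult_le_compat_r; lra).
  lra.
Qed.

Lemma Cmod_minus_pos (z w : C) : z <> w -> 0 < Cmod (z - w).
Proof.
  intros H. apply Cmod_gt_0. intros E. apply H.
  replace z with ((z - w) + w)%C by ring. rewrite E. ring.
Qed.

Lemma has_cderiv_at_inv_minus w z : z <> w ->
  has_cderiv_at (fun x => Cinv (Cminus x w)) z (- (Cinv (z - w) * Cinv (z - w)))%C.
Proof.
  intros Hzw eps Heps. assert (Hp := Cmod_minus_pos z w Hzw).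
  set (p := Cmod (z - w)) in *.
  assert (Hp3 : 0 < p ^ 3) by now apply pow_lt.
  assert (Hq : 0 < eps * p ^ 3 / 2) by (apply Rdiv_lt_0_compat; [apply Rmult_lt_0_compat|]; lra).
  (* The error is exactly h^2 / ((z-w)^2 (z+h-w)). The first bound gives |z+h-w| >= p/2, so the
     denominator is at least p^3/2 in modulus. *)
  exists (Rmin (p / 2) (eps * p ^ 3 / 2)). split; [apply Rmin_glb_lt; lra|]. intros h Hh. toC.
  assert (Hm1 := Rmin_l (p / 2) (eps * p ^ 3 / 2)). assert (Hm2 := Rmin_r (p / 2) (eps * p ^ 3 / 2)).
  assert (Hge : p / 2 <= Cmod (z + h - w)).
  { assert (H := Cmod_triangle_inv (z - w) (- h)). rewrite Cmod_opp in H. fold p in H.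
    replace (z - w - - h)%C with (z + h - w)%C in H by ring. lra. }
  assert (N1 : (z - w <> 0)%C) by (apply Cmod_gt_0; exact Hp).
  assert (N2 : (z + h - w <> 0)%C) by (apply Cmod_gt_0; lra).
  replace (/ (z + h - w) - / (z - w) - - (/ (z - w) * / (z - w)) * h)%C with
    (h * h * / ((z - w) * (z - w) * (z + h - w)))%C by (field; now split).
  rewrite !Cmod_mult, Cmod_inv by (repeat apply Cmult_neq_0; easy).
  rewrite !Cmod_mult. fold p.
  assert (Hh0 := Cmod_ge_0 h).
  rewrite Rmult_assoc, (Rmult_comm eps). apply Rmult_le_compat_l; [easy|].
  apply Rmult_le_reg_r with (p * p * Cmod (z + h - w)).
  { repeat apply Rmult_lt_0_compat; lra. }
  rewrite Rmult_assoc, Rinv_l, Rmult_1_r.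
  2:{ apply Rgt_not_eq. repeat apply Rmult_lt_0_compat; lra. }
  apply Rle_trans with (eps * (p * p * (p / 2))); [replace (eps * (p * p * (p / 2))) with (eps * p ^ 3 / 2) by field; lra|].
  apply Rmult_le_compat_l; [lra|]. apply Rmult_le_compat_l; [|easy].
  apply Rmult_le_pos; lra.
Qed.

Lemma has_cderiv_at_inv_minus_pow w z n : z <> w ->
  has_cderiv_at (fun x => Complex.Cpow (Cinv (Cminus x w)) (S n)) z
    (- RtoC (INR (S n)) * Complex.Cpow (Cinv (z - w)) (S (S n)))%C.
Proof.
  intros Hzw. induction n as [|n IH].
  - simpl Complex.Cpow. change (INR 1) with 1.
    apply (has_cderiv_at_ext_loc (fun x => Cinv (Cminus x w)) _ z _ 1); [lra| |].
    + intros x _. cbv beta. toC. ring.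
    + replace (- RtoC 1 * (/ (z - w) * (/ (z - w) * RtoC 1)))%C with
        (- (/ (z - w) * / (z - w)))%C by ring.
      now apply has_cderiv_at_inv_minus.
  - assert (H := has_cderiv_at_mult _ _ _ _ _ (has_cderiv_at_inv_minus w z Hzw) IH).
    change (Complex.Cpow (/ (z - w)) (S (S (S n)))) with
      (/ (z - w) * Complex.Cpow (/ (z - w)) (S (S n)))%C.
    replace (- RtoC (INR (S (S n))) * (/ (z - w) * (/ (z - w)) ^ S (S n)))%C with
      (- (/ (z - w) * / (z - w)) * (/ (z - w)) ^ S n +
       / (z - w) * (- RtoC (INR (S n)) * (/ (z - w)) ^ S (S n)))%C.
    + exact H.
    + rewrite (S_INR (S n)), RtoC_plus. simpl Complex.Cpow. ring.
Qed.

(** The successive derivatives of c / (z - w). *)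
Definition pole_tower (c : R) (w : C) (l : nat) (z : C) : C :=
  (RtoC (c * ((-1) ^ l * INR (fact l))) * Complex.Cpow (/ (z - w)) (S l))%C.

Lemma has_cderiv_at_pole_tower c w l z : z <> w ->
  has_cderiv_at (pole_tower c w l) z (pole_tower c w (S l) z).
Proof.
  intros Hzw.
  assert (H := has_cderiv_at_mult _ _ _ _ _
    (has_cderiv_at_const (RtoC (c * ((-1) ^ l * INR (fact l)))) z)
    (has_cderiv_at_inv_minus_pow w z l Hzw)).
  unfold pole_tower at 2. rewrite fact_simpl, mult_INR.
  replace (c * ((-1) ^ S l * (INR (S l) * INR (fact l)))) with
    ((c * ((-1) ^ l * INR (fact l))) * - INR (S l)) by (simpl; ring).
  rewrite RtoC_mult, RtoC_opp.
  replace (RtoC (c * ((-1) ^ l * INR (fact l))) * - RtoC (INR (S l)) * (/ (z - w)) ^ S (S l))%C with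
    (RtoC 0 * (/ (z - w)) ^ S l + RtoC (c * ((-1) ^ l * INR (fact l))) * (- RtoC (INR (S l)) * (/ (z - w)) ^ S (S l)))%C
    by ring.
  exact H.
Qed.

Lemma Cmod_pole_tower c w l z r : 0 <= c -> 0 < r -> r <= Cmod (z - w) ->
  Cmod (pole_tower c w l z) <= c * INR (fact l) * (/ r) ^ S l.
Proof.
  intros Hc Hr Hz. unfold pole_tower.
  assert (Hf := pos_INR (fact l)).
  rewrite Cmod_mult, Cmod_R, Cmod_pow, !Rabs_mult, pow_1_abs, Rmult_1_l, !Rabs_pos_eq by lra.
  apply Rmult_le_compat_l; [now apply Rmult_le_pos|].
  assert (N : (z - w <> 0)%C) by (apply Cmod_gt_0; lra).
  rewrite Cmod_inv by easy. apply pow_incr. split.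
  - left. apply Rinv_0_lt_compat. lra.
  - now apply Rinv_le_contravar.
Qed.

(** An element of A^infinity given by the continuous extensions of all its derivatives, so that
    boundary values are at hand; values off the closure are arbitrary. *)
Definition smooth_tower (Om : C -> Prop) (T : nat -> C -> C) : Prop :=
  (forall l, continuous_on (closure Om) (T l)) /\ (forall l, is_cderiv_on Om (T l) (T (S l))).

Lemma smooth_tower_plus_pole Om T c w r : smooth_tower Om T -> 0 < r ->
  (forall z, closure Om z -> r <= Cmod (z - w)) ->
  smooth_tower Om (fun l z => Cplus (T l z) (pole_tower c w l z)).
Proof.
  intros [HT1 HT2] Hr Hw.
  assert (Hne : forall z, closure Om z -> z <> w).
  { intros z Hz ->. specialize (Hw w Hz). replace (w - w)%C with (RtoC 0) in Hw by ring.
    rewrite Cmod_0 in Hw. lra. }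
  split.
  - intros l z Hz eps Heps.
    destruct (HT1 l z Hz (eps / 2) ltac:(lra)) as [d1 [Hd1 H1]].
    destruct (has_cderiv_at_cont _ _ _ (has_cderiv_at_pole_tower c w l z (Hne z Hz)) (eps / 2) ltac:(lra))
      as [d2 [Hd2 H2]].
    exists (Rmin d1 d2). split; [now apply Rmin_glb_lt|]. intros x Hx Hxz. toC.
    assert (Hm1 := Rmin_l d1 d2). assert (Hm2 := Rmin_r d1 d2).
    specialize (H1 x Hx ltac:(lra)). specialize (H2 x ltac:(lra)).
    replace (T l x + pole_tower c w l x - (T l z + pole_tower c w l z))%C with
      ((T l x - T l z) + (pole_tower c w l x - pole_tower c w l z))%C by ring.
    eapply Rle_lt_trans; [apply Cmod_triangle|]. lra.
  - intros l z Hz. apply has_cderiv_at_plus; [now apply HT2|].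
    apply has_cderiv_at_pole_tower, Hne, closure_incl, Hz.
Qed.

(** [A_ball] quantifies over all towers of derivatives; by uniqueness it can be checked on one. *)
Lemma deriv_tower_unique Om f D D' : open_set Om -> deriv_tower Om f D -> deriv_tower Om f D' ->
  forall l z, Om z -> D l z = D' l z.
Proof.
  intros Ho [H0 H] [H0' H']. induction l as [|l IH]; intros z Hz.
  - rewrite H0, H0'; easy.
  - destruct (Ho z Hz) as [r [Hr Hb]]. toC.
    apply (has_cderiv_at_unique (D' l) z); [|now apply H'].
    apply (has_cderiv_at_ext_loc (D l) _ z _ r Hr); [|now apply H].
    intros w Hw. now apply IH, Hb.
Qed.

Lemma smooth_tower_deriv_tower Om T f : smooth_tower Om T -> (forall z, Om z -> T O z = f z) ->
  deriv_tower Om f T.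
Proof. intros [_ H] Hf. now split. Qed.

Lemma smooth_tower_A_infty Om T : smooth_tower Om T -> A_infty Om (T O).
Proof.
  intros HT. split.
  - intros z Hz. exists (T 1%nat z). now apply HT.
  - exists T. split; [now apply smooth_tower_deriv_tower|].
    intros l. exists (T l). split; [apply HT|easy].
Qed.

Lemma A_infty_smooth_tower Om f : open_set Om -> A_infty Om f ->
  exists T, smooth_tower Om T /\ forall z, Om z -> T O z = f z.
Proof.
  intros Ho [_ [D [[HD0 HD] HE]]].
  destruct (functional_choice _ HE) as [T HT]. exists T. split; [split|].
  - intros l. apply HT.
  - intros l z Hz. destruct (Ho z Hz) as [r [Hr Hb]]. toC.
    rewrite (proj2 (HT (S l))) by easy.
    apply (has_cderiv_at_ext_loc (D l) _ z _ r Hr); [|now apply HD].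
    intros w Hw. symmetry. now apply HT, Hb.
  - intros z Hz. rewrite (proj2 (HT O)) by easy. now apply HD0.
Qed.

(** This is how a seminorm taken over [Om] controls the values on the boundary curves. *)
Lemma closure_le Om F G M : continuous_on (closure Om) F -> continuous_on (closure Om) G ->
  (forall z, Om z -> Cmod (G z - F z) <= M) ->
  forall z, closure Om z -> Cmod (G z - F z) <= M.
Proof.
  intros HF HG HM z Hz. apply le_epsilon. intros eps Heps.
  destruct (HF z Hz (eps / 2) ltac:(lra)) as [d1 [Hd1 H1]].
  destruct (HG z Hz (eps / 2) ltac:(lra)) as [d2 [Hd2 H2]].
  destruct (Hz (Rmin d1 d2)) as [w [Hw Hwz]]; [now apply Rmin_glb_lt|].
  assert (Hm1 := Rmin_l d1 d2). assert (Hm2 := Rmin_r d1 d2).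
  specialize (H1 w (closure_incl _ _ Hw) ltac:(lra)). specialize (H2 w (closure_incl _ _ Hw) ltac:(lra)).
  specialize (HM w Hw). toC.
  replace (G z - F z)%C with ((G w - F w) + ((F w - F z) - (G w - G z)))%C by ring.
  eapply Rle_trans; [apply Cmod_triangle|].
  assert (H := Cmod_triangle (F w - F z) (- (G w - G z))). rewrite Cmod_opp in H.
  unfold Cminus at 2. lra.
Qed.

Lemma closure_eq Om F G : continuous_on (closure Om) F -> continuous_on (closure Om) G ->
  (forall z, Om z -> F z = G z) -> forall z, closure Om z -> F z = G z.
Proof.
  intros HF HG H z Hz. apply Cmod_small_eq. intros eps Heps.
  apply (closure_le Om G F); [easy|easy| |easy].
  intros x Hx. rewrite H by easy. replace (G x - G x)%C with (RtoC 0) by ring.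
  rewrite Cmod_0. lra.
Qed.

Lemma A_ball_smooth_tower Om f N eps T T' : open_set Om -> smooth_tower Om T -> smooth_tower Om T' ->
  (forall z, Om z -> T O z = f z) ->
  (forall l z, (l <= N)%nat -> Om z -> Cmod (T' l z - T l z) < eps) ->
  A_ball Om f N eps (T' O).
Proof.
  intros Ho HT HT' Hf H Df Dg Hdf Hdg l Hl z Hz. toC.
  rewrite (deriv_tower_unique Om f Df T Ho Hdf (smooth_tower_deriv_tower _ _ _ HT Hf) l z Hz).
  rewrite (deriv_tower_unique Om _ Dg T' Ho Hdg
    (smooth_tower_deriv_tower _ _ _ HT' (fun z _ => eq_refl)) l z Hz).
  now apply H.
Qed.

(** * Uniform limits of towers *)

Lemma RtoC_m1 : RtoC (-1) = (- RtoC 1)%C.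
Proof. rewrite <- RtoC_opp. f_equal; ring. Qed.

(** The mean value theorem fails for complex values, so it is applied to a real-linear functional p
    of norm at most 1 along the segment; p will be the real or the imaginary part. *)
Lemma mean_value_functional (p : C -> R) f f' (z h : C) M :
  (forall a b, p (a - b)%C = p a - p b) -> (forall k w, p (RtoC k * w)%C = k * p w) ->
  (forall w, Rabs (p w) <= Cmod w) ->
  (forall s, 0 <= s <= 1 -> has_cderiv_at f (z + RtoC s * h)%C (f' (z + RtoC s * h)%C) /\
     Cmod (f' (z + RtoC s * h)%C) <= M) ->
  Rabs (p (f (z + h)%C) - p (f z)) <= M * Cmod h.
Proof.
  intros Hm Hs Hb Hf.
  destruct (MVT_cor2 (fun s => p (f (z + RtoC s * h)%C)) (fun s => p (f' (z + RtoC s * h) * h)%C) 0 1)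
    as [c [Hc Hc']]; [lra| |].
  - intros s Hs01 eps Heps. destruct (Hf s Hs01) as [Hd _].
    assert (Hh := Cmod_ge_0 h).
    (* The added 1 covers h = 0 and makes the final inequality strict. *)
    assert (He : 0 < eps / (Cmod h + 1)) by (apply Rdiv_lt_0_compat; lra).
    destruct (Hd _ He) as [d [Hd0 Hd1]].
    assert (Hq : 0 < d / (Cmod h + 1)) by (apply Rdiv_lt_0_compat; lra).
    exists (mkposreal _ Hq). intros k Hk Hkd. simpl in Hkd.
    assert (Hkh : Cmod (RtoC k * h) = Rabs k * Cmod h) by now rewrite Cmod_mult, Cmod_R.
    assert (Hk0 := Rabs_pos_lt k Hk).
    specialize (Hd1 (RtoC k * h)%C). toC. rewrite Hkh in Hd1.
    assert (Hlt : Rabs k * Cmod h < d).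
    { apply Rle_lt_trans with (Rabs k * (Cmod h + 1)); [apply Rmult_le_compat_l; lra|].
      apply Rmult_lt_reg_r with (/ (Cmod h + 1)); [apply Rinv_0_lt_compat; lra|].
      rewrite Rmult_assoc, Rinv_r, Rmult_1_r by lra. exact Hkd. }
    specialize (Hd1 Hlt).
    replace (z + RtoC (s + k) * h)%C with (z + RtoC s * h + RtoC k * h)%C
      by (rewrite RtoC_plus; ring).
    apply Rmult_lt_reg_r with (Rabs k); [easy|]. rewrite <- Rabs_mult.
    replace (((p (f (z + RtoC s * h + RtoC k * h)%C) - p (f (z + RtoC s * h)%C)) / k -
       p (f' (z + RtoC s * h) * h)%C) * k) with
      (p (f (z + RtoC s * h + RtoC k * h) - f (z + RtoC s * h) - f' (z + RtoC s * h) * (RtoC k * h))%C).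
    2:{ rewrite !Hm. replace (f' (z + RtoC s * h) * (RtoC k * h))%C with
          (RtoC k * (f' (z + RtoC s * h) * h))%C by ring. rewrite Hs. field. easy. }
    eapply Rle_lt_trans; [apply Hb|]. eapply Rle_lt_trans; [exact Hd1|].
    replace (eps / (Cmod h + 1) * (Rabs k * Cmod h)) with (eps * Rabs k * (Cmod h / (Cmod h + 1))) by (field; lra).
    assert (0 < eps * Rabs k) by now apply Rmult_lt_0_compat.
    rewrite <- (Rmult_1_r (eps * Rabs k)) at 2. apply Rmult_lt_compat_l; [easy|].
    apply Rmult_lt_reg_r with (Cmod h + 1); [lra|]. unfold Rdiv.
    rewrite Rmult_assoc, Rinv_l, Rmult_1_r by lra. lra.
  - cbv beta in Hc. replace (z + RtoC 1 * h)%C with (z + h)%C in Hc by ring.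
    replace (z + RtoC 0 * h)%C with z in Hc by ring.
    rewrite Hc, Rminus_0_r, Rmult_1_r. eapply Rle_trans; [apply Hb|].
    rewrite Cmod_mult. apply Rmult_le_compat_r; [apply Cmod_ge_0|]. apply Hf. lra.
Qed.

Lemma mean_value_ineq f f' (z h : C) M :
  (forall s, 0 <= s <= 1 -> has_cderiv_at f (z + RtoC s * h)%C (f' (z + RtoC s * h)%C) /\
     Cmod (f' (z + RtoC s * h)%C) <= M) ->
  Cmod (f (z + h) - f z)%C <= 2 * M * Cmod h.
Proof.
  intros H.
  assert (H1 := mean_value_functional fst f f' z h M (fun _ _ => eq_refl)
    ltac:(intros; simpl; ring) fst_le_Cmod H).
  assert (H2 := mean_value_functional snd f f' z h M (fun _ _ => eq_refl)
    ltac:(intros; simpl; ring) snd_le_Cmod H).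
  eapply Rle_trans; [apply Cmod_le_abs|]. simpl. unfold Rminus in *. lra.
Qed.

Lemma Cauchy_limit (u : nat -> C) :
  (forall eps, 0 < eps -> exists N, forall k, (N <= k)%nat -> Cmod (u k - u N) <= eps) ->
  exists L : C, forall eps, 0 < eps -> exists N, forall k, (N <= k)%nat -> Cmod (u k - L) <= eps.
Proof.
  intros H.
  assert (Hp : forall p : C -> R, (forall a b, p (a - b)%C = p a - p b) ->
    (forall w, Rabs (p w) <= Cmod w) -> exists l, Un_cv (fun k => p (u k)) l).
  { intros p Hm Hb.
    assert (Hc : Cauchy_crit (fun k => p (u k))).
    { intros eps Heps. destruct (H (eps / 3) ltac:(lra)) as [N HN]. exists N.
      intros i j Hi Hj. unfold Rdist. rewrite <- Hm. eapply Rle_lt_trans; [apply Hb|].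
      replace (u i - u j)%C with ((u i - u N) + - (u j - u N))%C by ring.
      eapply Rle_lt_trans; [apply Cmod_triangle|]. rewrite Cmod_opp.
      assert (H1 := HN i Hi). assert (H2 := HN j Hj). lra. }
    destruct (R_complete _ Hc) as [l Hl]. now exists l. }
  destruct (Hp fst) as [l1 H1]; [easy|apply fst_le_Cmod|].
  destruct (Hp snd) as [l2 H2]; [easy|apply snd_le_Cmod|].
  exists (l1, l2). intros eps Heps.
  destruct (H1 (eps / 2) ltac:(lra)) as [N1 HN1]. destruct (H2 (eps / 2) ltac:(lra)) as [N2 HN2].
  exists (max N1 N2). intros k Hk. unfold Rdist in *.
  specialize (HN1 k ltac:(lia)). specialize (HN2 k ltac:(lia)).
  eapply Rle_trans; [apply Cmod_le_abs|]. simpl. unfold Rminus in *. lra.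
Qed.

(** Order l is controlled from stage l on (from the start if l <= N0), which suffices for uniform
    convergence of every order. Since r halves, each step r_k / 2 is at most r_k - r_(k+1), so the
    distances telescope to r_k. *)
Lemma smooth_tower_limit Om N0 (T : nat -> nat -> C -> C) (r : nat -> R) :
  open_set Om -> (forall k, smooth_tower Om (T k)) ->
  (forall k, 0 < r k) -> (forall k, r (S k) <= r k / 2) ->
  (forall k l z, (l <= max N0 k)%nat -> closure Om z -> Cmod (T (S k) l z - T k l z) <= r k / 2) ->
  exists T', smooth_tower Om T' /\
    forall k l z, (l <= max N0 k)%nat -> closure Om z -> Cmod (T' l z - T k l z) <= r k.
Proof.
  intros Ho HT Hr0 Hr Hd.
  assert (Htel : forall k l z, (l <= max N0 k)%nat -> closure Om z -> forall i,
    Cmod (T (i + k)%nat l z - T k l z) <= r k - r (i + k)%nat).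
  { intros k l z Hl Hz. induction i as [|i IH].
    - simpl. replace (T k l z - T k l z)%C with (RtoC 0) by (toC; ring). rewrite Cmod_0. lra.
    - simpl. specialize (Hd (i + k)%nat l z ltac:(lia) Hz). specialize (Hr (i + k)%nat).
      assert (H := Cmod_minus_triangle (T (S (i + k)) l z) (T (i + k)%nat l z) (T k l z)). lra. }
  assert (Hle : forall k l z i, (l <= max N0 k)%nat -> closure Om z -> (k <= i)%nat ->
    Cmod (T i l z - T k l z) <= r k).
  { intros k l z i Hl Hz Hi. replace i with ((i - k) + k)%nat by lia.
    assert (H := Htel k l z Hl Hz (i - k)%nat). assert (H' := Hr0 ((i - k) + k)%nat). lra. }
  assert (Hgeo : forall k, r k <= r O * (1 / 2) ^ k).
  { induction k as [|k IH]; simpl; [lra|]. specialize (Hr k). lra. }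
  assert (Hsmall : forall eps, 0 < eps -> exists N, forall k, (N <= k)%nat -> r k <= eps).
  { intros eps Heps.
    destruct (pow_lt_1_zero (1 / 2) ltac:(rewrite Rabs_pos_eq; lra) (eps / r O)) as [N HN].
    { apply Rdiv_lt_0_compat; [lra|apply Hr0]. }
    exists N. intros k Hk. specialize (HN k Hk). rewrite Rabs_pos_eq in HN by (apply pow_le; lra).
    eapply Rle_trans; [apply Hgeo|]. specialize (Hr0 O).
    replace eps with (r O * (eps / r O)) by (field; lra). apply Rmult_le_compat_l; lra. }
  assert (Hlim : forall q : nat * C, exists L : C, closure Om (snd q) -> forall eps, 0 < eps ->
     exists N, forall k, (N <= k)%nat -> Cmod (T k (fst q) (snd q) - L) <= eps).
  { intros [l z]. simpl. destruct (classic (closure Om z)) as [Hz|Hz]; [|exists (RtoC 0); easy].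
    destruct (Cauchy_limit (fun k => T k l z)) as [L HL]; [|now exists L].
    intros eps Heps. destruct (Hsmall eps Heps) as [N HN]. exists (max N l). intros k Hk.
    eapply Rle_trans; [apply Hle; [lia|easy|lia]|]. apply HN. lia. }
  destruct (functional_choice _ Hlim) as [L HL]. set (T' := fun l z => L (l, z)).
  assert (HT' : forall l z, closure Om z -> forall eps, 0 < eps ->
     exists N, forall k, (N <= k)%nat -> Cmod (T k l z - T' l z) <= eps).
  { intros l z Hz. exact (HL (l, z) Hz). }
  assert (Hbd : forall k l z, (l <= max N0 k)%nat -> closure Om z -> Cmod (T' l z - T k l z) <= r k).
  { intros k l z Hl Hz. apply le_epsilon. intros eps Heps.
    destruct (HT' l z Hz eps Heps) as [N HN]. specialize (HN (max N k) ltac:(lia)).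
    assert (H := Hle k l z (max N k) Hl Hz ltac:(lia)).
    assert (H1 := Cmod_minus_triangle (T' l z) (T (max N k) l z) (T k l z)).
    rewrite Cmod_minus_sym in HN. lra. }
  exists T'. split; [split|exact Hbd].
  - intros l z Hz eps Heps.
    destruct (Hsmall (eps / 4) ltac:(lra)) as [N HN]. set (k := max N l).
    assert (Hk := HN k ltac:(lia)).
    destruct (proj1 (HT k) l z Hz (eps / 4) ltac:(lra)) as [d [Hd0 Hd1]].
    exists d. split; [easy|]. intros w Hw Hwz. specialize (Hd1 w Hw Hwz). toC.
    assert (H1 := Hbd k l z ltac:(lia) Hz). assert (H2 := Hbd k l w ltac:(lia) Hw).
    replace (T' l w - T' l z)%C with
      ((T' l w - T k l w) + (T k l w - T k l z) + - (T' l z - T k l z))%C by ring.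
    eapply Rle_lt_trans; [apply Cmod_triangle|]. rewrite Cmod_opp.
    eapply Rle_lt_trans; [apply Rplus_le_compat_r, Cmod_triangle|]. lra.
  - intros l z Hz eps Heps.
    (* Stage k must control order l + 1, the derivative that is compared here. *)
    destruct (Hsmall (eps / 8) ltac:(lra)) as [N HN]. set (k := max N (S l)).
    assert (Hk := HN k ltac:(lia)).
    destruct (Ho z Hz) as [rr [Hrr Hball]].
    destruct (proj2 (HT k) l z Hz (eps / 4) ltac:(lra)) as [d [Hd0 Hd1]].
    exists (Rmin d rr). split; [now apply Rmin_glb_lt|]. intros h Hh. toC.
    assert (Hm1 := Rmin_l d rr). assert (Hm2 := Rmin_r d rr).
    specialize (Hd1 h ltac:(lra)). assert (Hh0 := Cmod_ge_0 h).
    assert (Hseg : forall s, 0 <= s <= 1 -> Om (z + RtoC s * h)%C).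
    { intros s Hs. apply Hball. replace (z + RtoC s * h - z)%C with (RtoC s * h)%C by ring.
      rewrite Cmod_mult, Cmod_R, Rabs_pos_eq by lra.
      apply Rle_lt_trans with (1 * Cmod h); [apply Rmult_le_compat_r; lra|lra]. }
    assert (Hzh : Om (z + h)%C).
    { replace (z + h)%C with (z + RtoC 1 * h)%C by ring. apply Hseg. lra. }
    (* The increment of T_i - T_k is bounded by a multiple of |h| uniformly in i, so the bound
       passes to the limit i -> infinity and exchanges limit and derivative. *)
    assert (HMV : forall i, (k <= i)%nat ->
      Cmod ((T i l (z + h) - T k l (z + h)) - (T i l z - T k l z))%C <= 2 * r k * Cmod h).
    { intros i Hi.
      assert (H := mean_value_ineq (fun x => Cplus (T i l x) (RtoC (-1) * T k l x))%C
        (fun x => Cplus (T i (S l) x) (RtoC 0 * T k l x + RtoC (-1) * T k (S l) x))%C z h (r k)).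
      cbv beta in H.
      replace ((T i l (z + h) - T k l (z + h)) - (T i l z - T k l z))%C with
       (T i l (z + h) + RtoC (-1) * T k l (z + h) - (T i l z + RtoC (-1) * T k l z))%C.
      2:{ rewrite RtoC_m1. ring. }
      apply H. intros s Hs. specialize (Hseg s Hs). split.
      - apply has_cderiv_at_plus; [now apply HT|].
        apply (has_cderiv_at_mult (fun _ => RtoC (-1))); [apply has_cderiv_at_const|now apply HT].
      - assert (H' := Hle k (S l) _ i ltac:(lia) (closure_incl _ _ Hseg) Hi).
        replace (T i (S l) (z + RtoC s * h) + (RtoC 0 * T k l (z + RtoC s * h) +
           RtoC (-1) * T k (S l) (z + RtoC s * h)))%C with
          (T i (S l) (z + RtoC s * h) - T k (S l) (z + RtoC s * h))%C; [easy|].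
        rewrite RtoC_m1. ring. }
    assert (HMV' : Cmod ((T' l (z + h) - T k l (z + h)) - (T' l z - T k l z))%C <= 2 * r k * Cmod h).
    { apply le_epsilon. intros e He.
      destruct (HT' l z (closure_incl _ _ Hz) (e / 2) ltac:(lra)) as [N1 HN1].
      destruct (HT' l _ (closure_incl _ _ Hzh) (e / 2) ltac:(lra)) as [N2 HN2].
      set (i := max k (max N1 N2)).
      specialize (HN1 i ltac:(lia)). specialize (HN2 i ltac:(lia)).
      specialize (HMV i ltac:(lia)).
      replace ((T' l (z + h) - T k l (z + h)) - (T' l z - T k l z))%C with
        (((T i l (z + h) - T k l (z + h)) - (T i l z - T k l z)) +
         (- (T i l (z + h) - T' l (z + h)) + (T i l z - T' l z)))%C by ring.
      eapply Rle_trans; [apply Cmod_triangle|].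
      assert (H := Cmod_triangle (- (T i l (z + h) - T' l (z + h)))%C (T i l z - T' l z)).
      rewrite Cmod_opp in H. lra. }
    assert (HS := Hbd k (S l) z ltac:(lia) (closure_incl _ _ Hz)).
    replace (T' l (z + h) - T' l z - T' (S l) z * h)%C with
      (((T' l (z + h) - T k l (z + h)) - (T' l z - T k l z)) +
       (T k l (z + h) - T k l z - T k (S l) z * h) + - ((T' (S l) z - T k (S l) z) * h))%C by ring.
    eapply Rle_trans; [apply Cmod_triangle|].
    eapply Rle_trans; [apply Rplus_le_compat_r, Cmod_triangle|].
    rewrite Cmod_opp, Cmod_mult.
    assert (H1 : Cmod (T' (S l) z - T k (S l) z) * Cmod h <= eps / 8 * Cmod h)
      by (apply Rmult_le_compat_r; lra).
    assert (H2 : 2 * r k * Cmod h <= 2 * (eps / 8) * Cmod h)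
      by (apply Rmult_le_compat_r; lra).
    assert (0 <= eps * Cmod h) by (apply Rmult_le_pos; lra).
    lra.
Qed.

(** * Jordan curves and their two sides *)

Definition has_tangent (g : R -> C) (t : R) (T : C) : Prop :=
  forall eps, 0 < eps -> exists d, 0 < d /\
    forall y, Rabs y < d -> Cmod (g (t + y)%R - g t - T * RtoC y)%C <= eps * Rabs y.

(** A tangent vector may be 0 here; nonzero ones come from [jordan_tangent_dense]. *)
Record jordan (g : R -> C) : Prop := {
  jordan_tangent : forall t, exists T, has_tangent g t T;
  jordan_period : forall t, g (t + 2 * PI) = g t;
  jordan_inj : forall q t, q < t < q + 2 * PI -> g t <> g q }.

Definition Rcont (s : R -> C) : Prop :=
  (forall t, continuity_pt (fun x => fst (s x)) t) /\ (forall t, continuity_pt (fun x => snd (s x)) t).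

Lemma has_tangent_component (p : C -> R) g t T :
  (forall a b, p (a - b)%C = p a - p b) -> (forall k w, p (w * RtoC k)%C = k * p w) ->
  (forall w, Rabs (p w) <= Cmod w) ->
  has_tangent g t T -> derivable_pt_lim (fun x => p (g x)) t (p T).
Proof.
  intros Hm Hs Hb H eps Heps. destruct (H (eps / 2) ltac:(lra)) as [d [Hd Hy]].
  exists (mkposreal d Hd). intros y Hy0 Hyd. simpl in Hyd. specialize (Hy y Hyd).
  assert (Hp := Rabs_pos_lt y Hy0).
  apply Rmult_lt_reg_r with (Rabs y); [easy|]. rewrite <- Rabs_mult.
  replace (((p (g (t + y)) - p (g t)) / y - p T) * y) with (p (g (t + y)%R - g t - T * RtoC y)%C)
    by (rewrite !Hm, Hs; field; easy).
  eapply Rle_lt_trans; [apply Hb|]. eapply Rle_lt_trans; [exact Hy|].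
  apply Rmult_lt_compat_r; lra.
Qed.

Lemma has_tangent_fst g t T : has_tangent g t T -> derivable_pt_lim (fun x => fst (g x)) t (fst T).
Proof.
  apply has_tangent_component; [easy|intros; simpl; ring|apply fst_le_Cmod].
Qed.

Lemma has_tangent_snd g t T : has_tangent g t T -> derivable_pt_lim (fun x => snd (g x)) t (snd T).
Proof.
  apply has_tangent_component; [easy|intros; simpl; ring|apply snd_le_Cmod].
Qed.

Lemma jordan_cont g : jordan g -> Rcont g.
Proof.
  intros H. split; intros t; destruct (jordan_tangent g H t) as [T HT];
    apply derivable_continuous_pt.
  - exists (fst T). now apply has_tangent_fst.
  - exists (snd T). now apply has_tangent_snd.
Qed.

Lemma Rcont_const c : Rcont (fun _ => c).
Proof. split; intros t; apply continuity_pt_const; now intros x y. Qed.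

Lemma Rcont_minus f g : Rcont f -> Rcont g -> Rcont (fun t => f t - g t)%C.
Proof.
  intros [F1 F2] [G1 G2]. split; intros t.
  - apply (continuity_pt_minus _ _ t (F1 t) (G1 t)).
  - apply (continuity_pt_minus _ _ t (F2 t) (G2 t)).
Qed.

Lemma Rcont_mult f g : Rcont f -> Rcont g -> Rcont (fun t => f t * g t)%C.
Proof.
  intros [F1 F2] [G1 G2]. split; intros t.
  - apply (continuity_pt_minus _ _ t (continuity_pt_mult _ _ t (F1 t) (G1 t))
      (continuity_pt_mult _ _ t (F2 t) (G2 t))).
  - apply (continuity_pt_plus _ _ t (continuity_pt_mult _ _ t (F1 t) (G2 t))
      (continuity_pt_mult _ _ t (F2 t) (G1 t))).
Qed.

Lemma Rcont_conj f : Rcont f -> Rcont (fun t => Cconj (f t)).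
Proof.
  intros [F1 F2]. split; intros t; simpl; [apply F1|]. apply (continuity_pt_opp _ t (F2 t)).
Qed.

Lemma Rcont_Cmod f : Rcont f -> forall t, continuity_pt (fun x => Cmod (f x)) t.
Proof.
  intros [F1 F2] t. unfold Cmod.
  apply (continuity_pt_comp (fun x => fst (f x) ^ 2 + snd (f x) ^ 2) sqrt).
  - apply (continuity_pt_plus (fun x => fst (f x) ^ 2) (fun x => snd (f x) ^ 2)).
    + apply (continuity_pt_comp (fun x => fst (f x)) (fun x => x ^ 2)); [apply F1|].
      apply derivable_continuous_pt, derivable_pt_pow.
    + apply (continuity_pt_comp (fun x => snd (f x)) (fun x => x ^ 2)); [apply F2|].
      apply derivable_continuous_pt, derivable_pt_pow.
  - apply continuity_pt_sqrt. assert (H1 := pow2_ge_0 (fst (f t))).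
    assert (H2 := pow2_ge_0 (snd (f t))). lra.
Qed.

(** The principal square root on the right half-plane, with real part u = sqrt((|f| + Re f)/2) > 0
    and imaginary part Im f / (2u). The last clause records that it depends on the value f(t) alone,
    hence preserves periodicity. *)
Lemma Rcont_sqrt f : Rcont f -> (forall t, 0 < fst (f t)) -> exists s, Rcont s /\
  (forall t, s t * s t = f t)%C /\ (forall t t', f t = f t' -> s t = s t').
Proof.
  intros Hf Hpos.
  set (u := fun t => sqrt ((Cmod (f t) + fst (f t)) / 2)).
  assert (Hin : forall t, 0 < (Cmod (f t) + fst (f t)) / 2).
  { intros t. assert (H := Cmod_ge_0 (f t)). specialize (Hpos t). lra. }
  assert (Hu : forall t, 0 < u t) by (intros t; apply sqrt_lt_R0, Hin).
  assert (Huc : forall t, continuity_pt u t).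
  { intros t. apply (continuity_pt_comp (fun x => (Cmod (f x) + fst (f x)) / 2) sqrt).
    - apply (continuity_pt_mult (fun x => Cmod (f x) + fst (f x)) (fun _ => / 2)).
      + apply (continuity_pt_plus (fun x => Cmod (f x))); [now apply Rcont_Cmod|apply Hf].
      + apply continuity_pt_const; now intros x y.
    - apply continuity_pt_sqrt. left; apply Hin. }
  exists (fun t => (u t, snd (f t) * / (2 * u t))). split; [split|split].
  - exact Huc.
  - intros t. simpl. apply (continuity_pt_mult (fun x => snd (f x)) (fun x => / (2 * u x))).
    + apply Hf.
    + apply (continuity_pt_inv (fun x => 2 * u x)).
      * apply (continuity_pt_mult (fun _ => 2) u); [apply continuity_pt_const; now intros x y|apply Huc].
      * specialize (Hu t). lra.
  - intros t. specialize (Hu t). specialize (Hin t).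
    assert (Hsq : u t * u t = (Cmod (f t) + fst (f t)) / 2) by (apply sqrt_sqrt; lra).
    assert (Hmod := Cmod2_alt (f t)). unfold Re, Im in Hmod.
    destruct (f t) as [x y] eqn:E. simpl fst in *. simpl snd in *.
    unfold Cmult; simpl. f_equal; [|field; lra].
    assert (Hy : y * / (2 * u t) * (y * / (2 * u t)) = (Cmod (x, y) - x) / 2).
    { apply Rmult_eq_reg_r with (4 * (u t * u t)); [|rewrite Hsq; lra].
      replace (y * / (2 * u t) * (y * / (2 * u t)) * (4 * (u t * u t))) with (y ^ 2) by (field; lra).
      rewrite Hsq. nra. }
    rewrite Hy, Hsq. lra.
  - intros t t' E. unfold u. now rewrite E.
Qed.

Lemma period_nat g : (forall t, g (t + 2 * PI) = g t :> C) ->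
  forall n t, g (t + INR n * (2 * PI)) = g t.
Proof.
  intros H. induction n as [|n IH]; intros t.
  - f_equal. simpl; ring.
  - rewrite S_INR. replace (t + (INR n + 1) * (2 * PI)) with ((t + INR n * (2 * PI)) + 2 * PI) by ring.
    now rewrite H.
Qed.

Lemma period_reduce g : (forall t, g (t + 2 * PI) = g t :> C) ->
  forall q t, exists t', q <= t' < q + 2 * PI /\ g t' = g t.
Proof.
  intros H q t. assert (Hpi := PI_RGT_0).
  set (k := Int_part ((t - q) / (2 * PI))).
  destruct (base_Int_part ((t - q) / (2 * PI))) as [H1 H2]. fold k in H1, H2.
  set (t' := t - IZR k * (2 * PI)).
  assert (Ht : t - q = (t - q) / (2 * PI) * (2 * PI)) by (field; lra).
  exists t'. split.
  - assert (IZR k * (2 * PI) <= (t - q) / (2 * PI) * (2 * PI)) by (apply Rmult_le_compat_r; lra).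
    assert ((t - q) / (2 * PI) * (2 * PI) < (IZR k + 1) * (2 * PI)) by (apply Rmult_lt_compat_r; lra).
    unfold t'. split; lra.
  - destruct (Z.le_gt_cases 0 k) as [Hk|Hk].
    + replace t with (t' + INR (Z.to_nat k) * (2 * PI)).
      * now rewrite period_nat.
      * rewrite INR_IZR_INZ, Z2Nat.id by easy. unfold t'; ring.
    + replace t' with (t + INR (Z.to_nat (- k)) * (2 * PI)).
      * now rewrite period_nat.
      * rewrite INR_IZR_INZ, Z2Nat.id by lia. rewrite opp_IZR. unfold t'; ring.
Qed.

Lemma Rcont_dist_min g z a b : Rcont g -> a <= b -> (forall t, a <= t <= b -> g t <> z) ->
  exists eta, 0 < eta /\ forall t, a <= t <= b -> eta <= Cmod (g t - z).
Proof.
  intros Hg Hab Hz.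
  destruct (continuity_ab_min (fun t => Cmod (g t - z)) a b Hab) as [m [Hm1 Hm2]].
  - intros t _. apply (Rcont_Cmod (fun t => g t - z)%C), Rcont_minus; [easy|apply Rcont_const].
  - exists (Cmod (g m - z)). split; [|easy]. apply Cmod_minus_pos, Hz, Hm2.
Qed.

(** Were all tangents 0 on an interval, both coordinates would be constant there, contrary to
    injectivity on a piece shorter than a period. *)
Lemma jordan_tangent_dense g a b : jordan g -> a < b ->
  exists t T, a < t < b /\ T <> RtoC 0 /\ has_tangent g t T.
Proof.
  intros Hg Hab. apply NNPP. intros Hn.
  assert (H0 : forall t, a < t < b -> has_tangent g t (RtoC 0)).
  { intros t Ht. destruct (jordan_tangent g Hg t) as [T HT].
    destruct (classic (T = RtoC 0)) as [->|HT0]; [easy|]. exfalso. apply Hn. now exists t, T. }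
  assert (Hpi := PI_RGT_0).
  set (x := a + (b - a) / 3). set (y := x + Rmin ((b - a) / 3) PI).
  assert (M0 : 0 < Rmin ((b - a) / 3) PI) by (apply Rmin_glb_lt; lra).
  assert (M1 := Rmin_l ((b - a) / 3) PI). assert (M2 := Rmin_r ((b - a) / 3) PI).
  assert (Hxy : x < y) by (unfold y; lra).
  apply (jordan_inj g Hg x y); [unfold y; lra|].
  destruct (MVT_cor2 (fun t => fst (g t)) (fun _ => 0) x y Hxy) as [c1 [E1 _]].
  { intros t Ht. apply (has_tangent_fst g t (RtoC 0)), H0. unfold y, x in Ht. lra. }
  destruct (MVT_cor2 (fun t => snd (g t)) (fun _ => 0) x y Hxy) as [c2 [E2 _]].
  { intros t Ht. apply (has_tangent_snd g t (RtoC 0)), H0. unfold y, x in Ht. lra. }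
  cbv beta in E1, E2. apply injective_projections; lra.
Qed.

Lemma Cmod_ge_half_sum (z : C) : (Rabs (fst z) + Rabs (snd z)) / 2 <= Cmod z.
Proof. assert (H1 := fst_le_Cmod z). assert (H2 := snd_le_Cmod z). lra. Qed.

(** Near q the curve follows its tangent line, at distance comparable to |d| from the point at
    height d on the normal; away from q, compactness and injectivity keep it at a fixed distance
    from g(q). *)
Lemma jordan_cone g q T : jordan g -> T <> RtoC 0 -> has_tangent g q T ->
  exists d0, 0 < d0 /\ forall d, Rabs d < d0 -> forall t,
    Cmod T * Rabs d / 2 <= Cmod (g t - (g q + RtoC d * Ci * T))%C.
Proof.
  intros Hg HT Ht. assert (HTp : 0 < Cmod T) by now apply Cmod_gt_0.
  assert (Hpi := PI_RGT_0).
  (* An error |T||y|/4 is absorbed by the lower bound |T|(|y| + |d|)/2 for |T(y - id)|. *)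
  destruct (Ht (Cmod T / 4) ltac:(lra)) as [dl [Hdl Hnear]].
  (* Parameters with |t' - q| >= dl must land in [q + dl', q + 2 PI - dl'], those below q after a
     shift by one period. *)
  set (dl' := Rmin dl PI / 2).
  assert (M0 : 0 < Rmin dl PI) by (apply Rmin_glb_lt; lra).
  assert (M1 := Rmin_l dl PI). assert (M2 := Rmin_r dl PI).
  destruct (Rcont_dist_min g (g q) (q + dl') (q + 2 * PI - dl') (jordan_cont g Hg))
    as [eta [Heta Hfar]]; [unfold dl'; lra| |].
  { intros t Hqt. apply (jordan_inj g Hg). unfold dl' in Hqt. lra. }
  assert (Hq : 0 < eta / (2 * Cmod T)) by (apply Rdiv_lt_0_compat; lra).
  exists (eta / (2 * Cmod T)). split; [easy|]. intros d Hd t.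
  assert (Hd0 := Rabs_pos d).
  assert (HdT : Cmod (RtoC d * Ci * T) = Rabs d * Cmod T).
  { rewrite !Cmod_mult, Cmod_R, Cmod_Ci. ring. }
  destruct (period_reduce g (jordan_period g Hg) (q - PI) t) as [t' [Ht' <-]].
  destruct (Rlt_dec (Rabs (t' - q)) dl) as [Hlt|Hge].
  - specialize (Hnear (t' - q) Hlt). replace (q + (t' - q)) with t' in Hnear by ring.
    set (y := t' - q) in *.
    assert (Hy := Rabs_pos y).
    assert (H := Cmod_triangle_inv (T * (RtoC y - RtoC d * Ci))
       (- (g t' - g q - T * RtoC y))%C).
    replace (T * (RtoC y - RtoC d * Ci) - - (g t' - g q - T * RtoC y))%C with
      (g t' - (g q + RtoC d * Ci * T))%C in H by ring.
    rewrite Cmod_opp, Cmod_mult in H.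
    assert (H2 := Cmod_ge_half_sum (RtoC y - RtoC d * Ci)).
    simpl in H2. replace (y + - (d * 0 - 0 * 1)) with y in H2 by ring.
    replace (0 + - (d * 1 + 0 * 0)) with (- d) in H2 by ring. rewrite Rabs_Ropp in H2.
    assert (H3 : Cmod T * ((Rabs y + Rabs d) / 2) <= Cmod T * Cmod (RtoC y - RtoC d * Ci))
      by (apply Rmult_le_compat_l; lra).
    assert (0 <= Cmod T * Rabs y) by (apply Rmult_le_pos; lra).
    lra.
  - assert (Hf : eta <= Cmod (g t' - g q)).
    { destruct (Rle_lt_dec q t') as [Hc|Hc].
      - apply Hfar. rewrite Rabs_pos_eq in Hge by lra. unfold dl'. lra.
      - rewrite <- (jordan_period g Hg t'). apply Hfar.
        rewrite Rabs_left in Hge by lra. unfold dl'. lra. }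
    assert (H := Cmod_triangle_inv (g t' - g q) (RtoC d * Ci * T)%C).
    replace (g t' - g q - RtoC d * Ci * T)%C with (g t' - (g q + RtoC d * Ci * T))%C in H by ring.
    rewrite HdT in H.
    assert (H1 : Rabs d * Cmod T <= eta / 2).
    { apply Rle_trans with (eta / (2 * Cmod T) * Cmod T); [apply Rmult_le_compat_r; lra|].
      right. field. lra. }
    assert (0 <= Cmod T * Rabs d) by (apply Rmult_le_pos; lra). lra.
Qed.

(* Two points are related when their winding numbers around g agree modulo 2: then
   (g - w0)(g - w) has a continuous periodic square root, up to a positive factor. *)
Definition even_winding (g : R -> C) (w0 w : C) : Prop :=
  exists (s : R -> C) (lam : R -> R), Rcont s /\ (forall t, s (t + 2 * PI) = s t) /\
    forall t, 0 < lam t /\ (s t * s t = RtoC (lam t) * ((g t - w0) * (g t - w)))%C.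

Lemma even_winding_refl g w : Rcont g -> (forall t, g (t + 2 * PI) = g t) -> even_winding g w w.
Proof.
  intros Hg Hp. exists (fun t => g t - w)%C, (fun _ => 1). split; [|split].
  - apply Rcont_minus; [easy|apply Rcont_const].
  - intros t. now rewrite Hp.
  - intros t. split; [lra|ring].
Qed.

(** If w' is nearer to w than the curve is, (g - w') conj(g - w) has positive real part, hence a
    continuous periodic root. Multiplying s by it replaces w by w' up to the positive factor |g -
    w|^2. *)
Lemma even_winding_near g w0 w w' : Rcont g -> (forall t, g (t + 2 * PI) = g t) ->
  (forall t, Cmod (w' - w) < Cmod (g t - w)) -> even_winding g w0 w -> even_winding g w0 w'.
Proof.
  intros Hg Hp Hw [s [lam [Hs [Hsp Hl]]]].
  destruct (Rcont_sqrt (fun t => (g t - w') * Cconj (g t - w))%C) as [u [Hu [Hu2 Hup]]].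
  - apply Rcont_mult; [|apply Rcont_conj]; (apply Rcont_minus; [easy|apply Rcont_const]).
  - intros t. specialize (Hw t).
    set (a := (g t - w)%C) in *.
    replace ((g t - w') * Cconj a)%C with (a * Cconj a - (w' - w) * Cconj a)%C by (unfold a; ring).
    rewrite <- Cmod2_conj.
    assert (H1 : Rabs (fst ((w' - w) * Cconj a)%C) <= Cmod (w' - w) * Cmod a).
    { eapply Rle_trans; [apply fst_le_Cmod|]. rewrite Cmod_mult, Cmod_conj. lra. }
    assert (Ha0 := Cmod_ge_0 (w' - w)).
    assert (H2 : Cmod (w' - w) * Cmod a < Cmod a * Cmod a) by (apply Rmult_lt_compat_r; lra).
    assert (H3 := Rle_abs (fst ((w' - w) * Cconj a)%C)).
    change (0 < Cmod a ^ 2 + - fst ((w' - w) * Cconj a)%C). simpl pow. lra.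
  - exists (fun t => s t * u t)%C, (fun t => lam t * Cmod (g t - w) ^ 2). split; [|split].
    + now apply Rcont_mult.
    + intros t. rewrite Hsp, (Hup (t + 2 * PI) t); [easy|]. now rewrite Hp.
    + intros t. destruct (Hl t) as [Hl1 Hl2]. split.
      * apply Rmult_lt_0_compat; [easy|]. apply pow_lt.
        assert (H := Cmod_ge_0 (w' - w)). specialize (Hw t). lra.
      * replace (s t * u t * (s t * u t))%C with ((s t * s t) * (u t * u t))%C by ring.
        rewrite Hl2, Hu2, RtoC_mult, Cmod2_conj. ring.
Qed.

(** By [even_winding_near] in both directions, the points related to w0 and the others form two open
    sets that split [Om]. *)
Lemma even_winding_connected g Om w0 w : Rcont g -> (forall t, g (t + 2 * PI) = g t) ->
  open_set Om -> connected_set Om -> (forall t, ~ Om (g t)) -> Om w0 -> Om w ->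
  even_winding g w0 w.
Proof.
  intros Hg Hp Ho Hc Hn H0 Hw.
  assert (Hsmall : forall z, Om z -> exists r, 0 < r /\ forall z', Cmod (z' - z) < r ->
    Om z' /\ (even_winding g w0 z <-> even_winding g w0 z')).
  { intros z Hz. destruct (Ho z Hz) as [r [Hr Hb]]. toC.
    assert (Hd : forall t, r <= Cmod (g t - z)).
    { intros t. apply Rnot_lt_le. intros Hlt. now apply (Hn t), Hb. }
    (* Half of the radius: z' must itself be farther from the curve than from z for the way back. *)
    exists (r / 2). split; [lra|]. intros z' Hz'. split; [apply Hb; lra|]. split.
    - apply even_winding_near; [easy|easy|]. intros t. specialize (Hd t). lra.
    - apply even_winding_near; [easy|easy|]. intros t. specialize (Hd t).
      assert (H := Cmod_minus_triangle (g t) z' z). rewrite Cmod_minus_sym. lra. }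
  destruct (Hc (fun z => Om z /\ even_winding g w0 z) (fun z => Om z /\ ~ even_winding g w0 z)) as [H|H].
  - intros z [Hz Hez]. destruct (Hsmall z Hz) as [r [Hr Hb]]. exists r. split; [easy|].
    intros z' Hz'. toC. destruct (Hb z' Hz') as [H1 H2]. tauto.
  - intros z [Hz Hez]. destruct (Hsmall z Hz) as [r [Hr Hb]]. exists r. split; [easy|].
    intros z' Hz'. toC. destruct (Hb z' Hz') as [H1 H2]. tauto.
  - intros z Hz. destruct (classic (even_winding g w0 z)); tauto.
  - tauto.
  - exfalso. apply (H w0 H0). split; [easy|]. now apply even_winding_refl.
  - specialize (H w Hw). destruct (classic (even_winding g w0 w)); tauto.
Qed.

(** In the coordinate z = (g - g(q))/T the two points are id and -id. The root yields r with r^2 =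
    mu (z - id)(conj z - id), mu > 0, so Re r^2 = mu (|z|^2 - d^2) and Im r^2 = -2 mu d Re z. If Re
    r = 0, then z lies on the segment from -id to id, which the curve meets only at q. But r(q) is
    imaginary and nonzero, and Re z changes sign at q, so Re r has opposite signs at the two ends of
    a period and must vanish inside. *)
Lemma jordan_sides g q T d : jordan g -> T <> RtoC 0 -> has_tangent g q T -> 0 < d ->
  (forall e, Rabs e <= d -> forall t,
    Cmod T * Rabs e / 2 <= Cmod (g t - (g q + RtoC e * Ci * T))%C) ->
  ~ even_winding g (g q + RtoC d * Ci * T)%C (g q - RtoC d * Ci * T)%C.
Proof.
  intros Hg HT Ht Hd Hcone [s [lam [Hs [Hsp Hl]]]].
  assert (HTp : 0 < Cmod T) by now apply Cmod_gt_0.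
  set (z := fun t => ((g t - g q) / T)%C).
  assert (Hz : forall t, (g t - g q = T * z t)%C) by (intros t; unfold z; field; easy).
  (* The conjugate factor turns the product of the two differences into their quotient, up to a
     positive factor. *)
  set (r := fun t => (s t * Cconj (g t - (g q - RtoC d * Ci * T)))%C).
  assert (Hr : Rcont r).
  { apply Rcont_mult; [easy|]. apply Rcont_conj, Rcont_minus; [now apply jordan_cont|apply Rcont_const]. }
  assert (Hrp : forall t, r (t + 2 * PI) = r t).
  { intros t. unfold r. now rewrite Hsp, (jordan_period g Hg). }
  set (mu := fun t => lam t * (Cmod T ^ 2 * Cmod (g t - (g q - RtoC d * Ci * T))%C ^ 2)).
  assert (Hmu : forall t, 0 < mu t).
  { intros t. apply Rmult_lt_0_compat; [apply Hl|].
    apply Rmult_lt_0_compat; apply pow_lt; [easy|].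
    assert (H := Hcone (- d)). rewrite Rabs_Ropp, Rabs_pos_eq in H by lra.
    specialize (H ltac:(lra) t). rewrite RtoC_opp in H.
    replace (g q + - RtoC d * Ci * T)%C with (g q - RtoC d * Ci * T)%C in H by ring.
    assert (0 < Cmod T * d) by now apply Rmult_lt_0_compat. lra. }
  assert (Hsq : forall t, (r t * r t = RtoC (mu t) * ((z t - RtoC d * Ci) * (Cconj (z t) - RtoC d * Ci)))%C).
  { intros t. unfold r, mu.
    set (k := (g t - (g q - RtoC d * Ci * T))%C).
    replace (s t * Cconj k * (s t * Cconj k))%C with ((s t * s t) * (Cconj k * Cconj k))%C by ring.
    destruct (Hl t) as [_ ->]. fold k. rewrite !RtoC_mult.
    rewrite (Cmod2_conj k), (Cmod2_conj T).
    replace (g t - (g q + RtoC d * Ci * T))%C with (T * (z t - RtoC d * Ci))%C.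
    2:{ replace (g t - (g q + RtoC d * Ci * T))%C with ((g t - g q) - RtoC d * Ci * T)%C by ring.
        rewrite Hz. ring. }
    assert (Hk : (Cconj k = Cconj T * (Cconj (z t) - RtoC d * Ci))%C).
    { replace k with (T * (z t + RtoC d * Ci))%C.
      2:{ unfold k. replace (g t - (g q - RtoC d * Ci * T))%C with ((g t - g q) + RtoC d * Ci * T)%C by ring.
          rewrite Hz. ring. }
      destruct T as [T1 T2], (z t) as [z1 z2]. unfold Cconj, Cmult, Cplus, Cminus, Copp, Ci; simpl.
      f_equal; ring. }
    rewrite Hk at 2. ring. }
  assert (Hzq : z q = RtoC 0).
  { unfold z. replace (g q - g q)%C with (RtoC 0) by ring. unfold Cdiv. ring. }
  clearbody r mu z.
  assert (H1 : forall t, fst (r t) ^ 2 - snd (r t) ^ 2 =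
    mu t * (fst (z t) ^ 2 + snd (z t) ^ 2 - d ^ 2)).
  { intros t. assert (H := f_equal fst (Hsq t)). simpl in H.
    replace (fst (r t) ^ 2 - snd (r t) ^ 2) with (fst (r t) * fst (r t) - snd (r t) * snd (r t)) by ring.
    rewrite H. ring. }
  assert (H2 : forall t, fst (r t) * snd (r t) = - (mu t * d * fst (z t))).
  { intros t. assert (H := f_equal snd (Hsq t)). simpl in H.
    apply Rmult_eq_reg_l with 2; [|lra].
    replace (2 * (fst (r t) * snd (r t))) with (fst (r t) * snd (r t) + snd (r t) * fst (r t)) by ring.
    rewrite H. ring. }
  (* A zero of Re r puts g(t) on the normal at height at most d; the cone condition at that very
     height makes the height 0, so g(t) = g(q). *)
  assert (Hnz : forall t, q < t < q + 2 * PI -> fst (r t) <> 0).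
  { intros t Hqt E. specialize (H1 t). specialize (H2 t). specialize (Hmu t). rewrite E in H1, H2.
    assert (Hre : fst (z t) = 0).
    { apply Rmult_eq_reg_l with (mu t * d); [|apply Rgt_not_eq; now apply Rmult_lt_0_compat].
      lra. }
    rewrite Hre in H1.
    assert (Him : snd (z t) ^ 2 <= d ^ 2).
    { apply Rmult_le_reg_l with (mu t); [easy|]. assert (Hp := pow2_ge_0 (snd (r t))). simpl in *. lra. }
    assert (Him' : Rabs (snd (z t)) <= d).
    { rewrite <- (pow2_abs (snd (z t))) in Him. apply Rsqr_incr_0_var; [unfold Rsqr; simpl in Him; lra|lra]. }
    assert (Hgt : g t = (g q + RtoC (snd (z t)) * Ci * T)%C).
    { replace (g t) with ((g t - g q) + g q)%C by ring. rewrite Hz.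
      replace (RtoC (snd (z t)) * Ci)%C with (z t).
      - ring.
      - rewrite (surjective_pairing (z t)) at 1. rewrite Hre. unfold Cmult; simpl. f_equal; ring. }
    assert (H := Hcone (snd (z t)) Him' t). rewrite <- Hgt in H.
    replace (g t - g t)%C with (RtoC 0) in H by ring. rewrite Cmod_0 in H.
    assert (Hs0 : Rabs (snd (z t)) = 0).
    { apply Rle_antisym; [|apply Rabs_pos]. apply Rmult_le_reg_l with (Cmod T / 2); lra. }
    apply (jordan_inj g Hg q t Hqt). rewrite Hgt.
    apply Rabs_eq_0 in Hs0. rewrite Hs0. ring. }
  assert (Hbq : snd (r q) <> 0).
  { intros E. specialize (H1 q). specialize (Hmu q). rewrite E, Hzq in H1. simpl in H1.
    assert (0 < mu q * (d * d)) by (repeat apply Rmult_lt_0_compat; lra).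
    assert (Hp := pow2_ge_0 (fst (r q))). simpl in Hp. nra. }
  destruct (Ht (Cmod T / 2) ltac:(lra)) as [d1 [Hd1 Hnear]].
  assert (Hre : forall y, Rabs y < d1 -> Rabs (fst (z (q + y)) - y) <= Rabs y / 2).
  { intros y Hy. specialize (Hnear y Hy). rewrite Hz in Hnear.
    replace (T * z (q + y)%R - T * RtoC y)%C with (T * (z (q + y)%R - RtoC y))%C in Hnear by ring.
    rewrite Cmod_mult in Hnear.
    change (fst (z (q + y)) - y) with (fst (z (q + y)%R - RtoC y)%C).
    eapply Rle_trans; [apply fst_le_Cmod|].
    apply Rmult_le_reg_l with (Cmod T); [easy|]. lra. }
  destruct (proj2 Hr q (Rabs (snd (r q))) (Rabs_pos_lt _ Hbq)) as [d2 [Hd2 Hb]].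
  assert (Hpi := PI_RGT_0).
  set (y := Rmin d1 (Rmin d2 PI) / 2).
  assert (M0 : 0 < Rmin d1 (Rmin d2 PI)) by (repeat apply Rmin_glb_lt; lra).
  assert (M1 := Rmin_l d1 (Rmin d2 PI)). assert (M2 := Rmin_r d1 (Rmin d2 PI)).
  assert (M3 := Rmin_l d2 PI). assert (M4 := Rmin_r d2 PI).
  assert (Hy : 0 < y) by (unfold y; lra).
  assert (Hsign : forall e, e = 1 \/ e = -1 -> 0 < snd (r q) * snd (r (q + e * y))).
  { intros e He.
    assert (Hlt : Rabs (snd (r (q + e * y)) - snd (r q)) < Rabs (snd (r q))).
    { apply (Hb (q + e * y)). split; [split; [easy|]|].
      - destruct He as [-> | ->]; lra.
      - simpl. unfold Rdist. replace (q + e * y - q) with (e * y) by ring.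
        rewrite Rabs_mult, (Rabs_pos_eq y) by lra.
        destruct He as [-> | ->]; [rewrite Rabs_R1|rewrite Rabs_left by lra]; unfold y; lra. }
    apply Rabs_lt_between in Hlt.
    destruct (Rtotal_order (snd (r q)) 0) as [Hs0|[Hs0|Hs0]]; [|easy|].
    - rewrite Rabs_left in Hlt by lra. apply Rmult_neg_neg; lra.
    - rewrite Rabs_pos_eq in Hlt by lra. apply Rmult_lt_0_compat; lra. }
  assert (S1 := Hsign 1 ltac:(tauto)). assert (S2 := Hsign (-1) ltac:(tauto)).
  replace (q + 1 * y) with (q + y) in S1 by ring.
  replace (q + -1 * y) with (q + - y) in S2 by ring.
  assert (R1 : 0 < fst (z (q + y))).
  { specialize (Hre y). rewrite Rabs_pos_eq in Hre by lra.
    specialize (Hre ltac:(unfold y; lra)). apply Rabs_le_between in Hre. lra. }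
  assert (R2 : fst (z (q + - y)) < 0).
  { specialize (Hre (- y)). rewrite Rabs_Ropp, (Rabs_pos_eq y) in Hre by lra.
    specialize (Hre ltac:(unfold y; lra)). apply Rabs_le_between in Hre. lra. }
  assert (P1 : fst (r (q + y)) * snd (r (q + y)) < 0).
  { rewrite H2. assert (0 < mu (q + y) * d * fst (z (q + y)))
      by (repeat apply Rmult_lt_0_compat; easy). lra. }
  assert (P2 : 0 < fst (r (q + - y)) * snd (r (q + - y))).
  { rewrite H2. assert (0 < mu (q + - y) * d * - fst (z (q + - y)))
      by (repeat apply Rmult_lt_0_compat; try easy; lra). lra. }
  (* Im r keeps its sign on both sides of q while Re r Im r changes sign; periodicity moves q - y to
     the far end of the period. *)
  assert (P3 : fst (r (q + y)) * fst (r (q + - y + 2 * PI)) <= 0).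
  { rewrite Hrp.
    set (a := fst (r (q + y))) in *. set (b := snd (r (q + y))) in *.
    set (a' := fst (r (q + - y))) in *. set (b' := snd (r (q + - y))) in *. set (c := snd (r q)) in *.
    assert (Hbb : 0 < b * b').
    { assert (Hcc : 0 < (c * b) * (c * b')) by now apply Rmult_lt_0_compat.
      replace ((c * b) * (c * b')) with ((c * c) * (b * b')) in Hcc by ring.
      assert (0 < c * c) by (apply Rsqr_pos_lt; easy). nra. }
    assert (Hab : (a * b) * (a' * b') < 0) by nra.
    apply Rnot_lt_le. intros Hlt.
    assert (0 < (a * a') * (b * b')) by now apply Rmult_lt_0_compat. lra. }
  destruct (IVT_cor (fun t => fst (r t)) (q + y) (q + - y + 2 * PI) (proj1 Hr)) as [t [Ht1 Ht2]];
    [unfold y; lra|exact P3|].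
  apply (Hnz t); [lra|exact Ht2].
Qed.

(** * Exterior points near the boundary *)

(* [ring] does not recognise complex equalities stated at the unfolded type [R * R]. *)
Ltac C_eq := match goal with |- @eq _ ?u ?v => change (@eq C u v) end.

(** At the supremum m of the parameters up to which the segment stays in [Om], the point is in the
    closure but not on the boundary, hence interior, and the segment would continue unless m = 1. *)
Lemma segment_in_open Om (z h : C) : open_set Om -> Om z ->
  (forall s, 0 <= s <= 1 -> ~ boundary Om (z + RtoC s * h)%C) -> Om (z + h)%C.
Proof.
  intros Ho Hz Hb.
  set (E := fun s => 0 <= s <= 1 /\ forall s', 0 <= s' <= s -> Om (z + RtoC s' * h)%C).
  assert (HE0 : E 0).
  { split; [lra|]. intros s' Hs'. replace s' with 0 by lra.
    now replace (z + RtoC 0 * h)%C with z by ring. }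
  destruct (completeness E) as [m [Hub Hlub]].
  { exists 1. intros s [Hs _]. lra. }
  { now exists 0. }
  assert (Hm0 : 0 <= m) by now apply Hub.
  assert (Hm1 : m <= 1) by (apply Hlub; intros s [Hs _]; lra).
  assert (Hh := Cmod_ge_0 h).
  assert (Hdist : forall s s', Cmod ((z + RtoC s * h) - (z + RtoC s' * h))%C = Rabs (s - s') * Cmod h).
  { intros s s'. replace ((z + RtoC s * h) - (z + RtoC s' * h))%C with (RtoC (s - s') * h)%C
      by (rewrite RtoC_minus; ring). now rewrite Cmod_mult, Cmod_R. }
  assert (Hlt : forall s, 0 <= s < m -> Om (z + RtoC s * h)%C).
  { intros s Hs. apply NNPP. intros Hn. assert (Hle : m <= s); [|lra].
    apply Hlub. intros e [He1 He2]. apply Rnot_lt_le. intros Hse. apply Hn, He2. lra. }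
  assert (Hcl : closure Om (z + RtoC m * h)%C).
  { intros eps Heps. destruct (Req_dec m 0) as [->|Hne].
    - exists z. split; [easy|]. toC. replace (z - (z + RtoC 0 * h))%C with (RtoC 0) by ring.
      now rewrite Cmod_0.
    - set (s := Rmax 0 (m - eps / 2 / (Cmod h + 1))).
      assert (He : 0 < eps / 2 / (Cmod h + 1)) by (repeat apply Rdiv_lt_0_compat; lra).
      assert (Hs0 := Rmax_l 0 (m - eps / 2 / (Cmod h + 1))).
      assert (Hs1 := Rmax_r 0 (m - eps / 2 / (Cmod h + 1))). fold s in Hs0, Hs1.
      assert (Hs2 : s < m) by (apply Rmax_lub_lt; lra).
      exists (z + RtoC s * h)%C. split; [apply Hlt; lra|]. toC.
      rewrite Hdist, Rabs_left by lra.
      apply Rle_lt_trans with (eps / 2 / (Cmod h + 1) * Cmod h); [apply Rmult_le_compat_r; lra|].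
      apply Rle_lt_trans with (eps / 2 / (Cmod h + 1) * (Cmod h + 1)); [apply Rmult_le_compat_l; lra|].
      replace (eps / 2 / (Cmod h + 1) * (Cmod h + 1)) with (eps / 2) by (field; lra). lra. }
  assert (Hball : exists r, 0 < r /\ forall w, Cmod (w - (z + RtoC m * h))%C < r -> Om w).
  { apply NNPP. intros Hn. apply (Hb m); [lra|]. split; [exact Hcl|].
    intros [r [Hr Hw]]. apply Hn. exists r. toC. now split. }
  destruct Hball as [r [Hr Hball]].
  destruct (Rle_lt_or_eq_dec m 1 Hm1) as [Hlt1|Heq].
  - exfalso. set (e := Rmin (1 - m) (r / 2 / (Cmod h + 1))).
    assert (Hr' : 0 < r / 2 / (Cmod h + 1)) by (repeat apply Rdiv_lt_0_compat; lra).
    assert (He : 0 < e) by (apply Rmin_glb_lt; lra).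
    assert (He1 : e <= 1 - m) by apply Rmin_l.
    assert (He2 : e <= r / 2 / (Cmod h + 1)) by apply Rmin_r.
    assert (Hin : E (m + e)).
    { split; [lra|]. intros s' Hs'. destruct (Rlt_dec s' m) as [H|H]; [apply Hlt; lra|].
      apply Hball. rewrite Hdist, Rabs_pos_eq by lra.
      apply Rle_lt_trans with (e * (Cmod h + 1)).
      - apply Rmult_le_compat; lra.
      - apply Rle_lt_trans with (r / 2 / (Cmod h + 1) * (Cmod h + 1)); [apply Rmult_le_compat_r; lra|].
        replace (r / 2 / (Cmod h + 1) * (Cmod h + 1)) with (r / 2) by (field; lra). lra. }
    specialize (Hub _ Hin). lra.
  - replace (z + h)%C with (z + RtoC 1 * h)%C by ring. apply Hball. rewrite Hdist, Heq.
    rewrite Rminus_diag, Rabs_R0. lra.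
Qed.

(** A point of [Om] within r of w would be joined to w by a segment inside the disc of radius r,
    which is free of boundary points, so w would lie in [Om]. *)
Lemma far_from_point Om (w : C) r : open_set Om -> 0 < r -> ~ Om w ->
  (forall z, boundary Om z -> r <= Cmod (z - w)) -> forall z, closure Om z -> r <= Cmod (z - w).
Proof.
  intros Ho Hr Hw Hb z Hz. apply Rnot_lt_le. intros Hlt.
  destruct (Hz (r - Cmod (z - w))) as [x [Hx Hxz]]; [lra|]. toC.
  assert (Hxw : Cmod (x - w) < r) by (assert (H := Cmod_minus_triangle x z w); lra).
  apply Hw. replace w with (x + (w - x))%C by ring. apply segment_in_open; [easy|easy|].
  intros s Hs Hbd. specialize (Hb _ Hbd).
  replace (x + RtoC s * (w - x) - w)%C with (RtoC (1 - s) * (x - w))%C in Hb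
    by (rewrite RtoC_minus; ring).
  rewrite Cmod_mult, Cmod_R, Rabs_pos_eq in Hb by lra.
  assert (H0 := Cmod_ge_0 (x - w)).
  assert ((1 - s) * Cmod (x - w) <= 1 * Cmod (x - w)) by (apply Rmult_le_compat_r; lra). lra.
Qed.

Lemma other_curves_far (g : nat -> R -> C) m j q :
  (forall k, (k < m)%nat -> jordan (g k)) ->
  (forall k, (k < m)%nat -> k <> j -> forall t, g k t <> g j q) ->
  exists eta, 0 < eta /\ forall k t, (k < m)%nat -> k <> j -> eta <= Cmod (g k t - g j q).
Proof.
  intros Hg Hne. induction m as [|m IH].
  - exists 1. split; [lra|]. intros; lia.
  - destruct IH as [e1 [He1 H1]]; [intros; apply Hg; lia|intros; apply Hne; [lia|easy]|].
    destruct (Nat.eq_dec m j) as [->|Hmj].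
    + exists e1. split; [easy|]. intros k t Hk Hkj. apply H1; lia.
    + assert (Hpi := PI_RGT_0).
      destruct (Rcont_dist_min (g m) (g j q) 0 (0 + 2 * PI)) as [e2 [He2 H2]];
        [apply jordan_cont, Hg; lia|lra|intros t _; apply Hne; [lia|easy]|].
      assert (M1 := Rmin_l e1 e2). assert (M2 := Rmin_r e1 e2).
      exists (Rmin e1 e2). split; [now apply Rmin_glb_lt|]. intros k t Hk Hkj.
      destruct (Nat.eq_dec k m) as [->|Hkm].
      * destruct (period_reduce (g m) (jordan_period _ (Hg m ltac:(lia))) 0 t) as [t' [Ht' <-]].
        specialize (H2 t' ltac:(lra)). lra.
      * specialize (H1 k t ltac:(lia) Hkj). lra.
Qed.

(* The sign exists because [Om] cannot lie on both sides of a Jordan curve. *)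
Lemma exterior_balls Om (g : nat -> R -> C) m j q T :
  open_set Om -> connected_set Om ->
  (forall k, (k < m)%nat -> jordan (g k)) ->
  (forall k, (k < m)%nat -> k <> j -> forall t, g k t <> g j q) ->
  (forall z, boundary Om z -> exists k t, (k < m)%nat /\ z = g k t) ->
  (forall t, ~ Om (g j t)) ->
  (j < m)%nat -> T <> RtoC 0 -> has_tangent (g j) q T ->
  exists sg, (sg = 1 \/ sg = -1) /\ forall dl, 0 < dl -> exists d, 0 < d < dl /\
    forall z, closure Om z -> Cmod T * d / 2 <= Cmod (z - (g j q + RtoC (sg * d) * Ci * T))%C.
Proof.
  intros Ho Hc Hg Hne Hbd Hn Hj HT Ht.
  assert (HTp : 0 < Cmod T) by now apply Cmod_gt_0.
  destruct (jordan_cone (g j) q T (Hg j Hj) HT Ht) as [d0 [Hd0 Hcone]].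
  destruct (other_curves_far g m j q Hg Hne) as [eta [Heta Hfar]].
  (* The second bound keeps the points on the normal within eta/2 of g_j(q), away from the other
     curves. *)
  set (d1 := Rmin d0 (eta / (2 * Cmod T))).
  assert (Hq : 0 < eta / (2 * Cmod T)) by (apply Rdiv_lt_0_compat; lra).
  assert (Hd1 : 0 < d1) by now apply Rmin_glb_lt.
  assert (M1 : d1 <= d0) by apply Rmin_l. assert (M2 : d1 <= eta / (2 * Cmod T)) by apply Rmin_r.
  assert (Hbdist : forall e, Rabs e < d1 -> forall z, boundary Om z ->
    Cmod T * Rabs e / 2 <= Cmod (z - (g j q + RtoC e * Ci * T))%C).
  { intros e He z Hz. destruct (Hbd z Hz) as [k [t [Hk ->]]].
    destruct (Nat.eq_dec k j) as [->|Hkj]; [apply Hcone; lra|].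
    specialize (Hfar k t Hk Hkj).
    assert (H := Cmod_triangle_inv (g k t - g j q) (RtoC e * Ci * T)%C).
    replace (g k t - g j q - RtoC e * Ci * T)%C with (g k t - (g j q + RtoC e * Ci * T))%C in H by ring.
    rewrite !Cmod_mult, Cmod_R, Cmod_Ci in H.
    assert (He0 := Rabs_pos e).
    assert (Hle : Rabs e * Cmod T <= eta / 2).
    { apply Rle_trans with (eta / (2 * Cmod T) * Cmod T); [apply Rmult_le_compat_r; lra|].
      right. field. lra. }
    lra. }
  assert (Hone : forall sg d, (sg = 1 \/ sg = -1) -> 0 < d < d1 ->
    ~ Om (g j q + RtoC (sg * d) * Ci * T)%C -> forall z, closure Om z ->
    Cmod T * d / 2 <= Cmod (z - (g j q + RtoC (sg * d) * Ci * T))%C).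
  { intros sg d Hsg Hd Hout. apply far_from_point; [easy| |easy|].
    - assert (0 < Cmod T * d) by (apply Rmult_lt_0_compat; lra). lra.
    - intros z Hz. assert (Habs : Rabs (sg * d) = d).
      { rewrite Rabs_mult, (Rabs_pos_eq d) by lra.
        destruct Hsg as [-> | ->]; [rewrite Rabs_R1|rewrite Rabs_left by lra]; ring. }
      rewrite <- Habs at 1. apply Hbdist; [now rewrite Habs|easy]. }
  assert (Htwo : forall d, 0 < d < d1 -> ~ Om (g j q + RtoC (1 * d) * Ci * T)%C \/
     ~ Om (g j q + RtoC (-1 * d) * Ci * T)%C).
  { intros d Hd. apply not_and_or. intros [H1 H2].
    apply (jordan_sides (g j) q T d (Hg j Hj) HT Ht); [lra| |].
    - intros e He. apply Hcone. lra.
    - apply (even_winding_connected _ Om); try easy.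
      + now apply jordan_cont, Hg.
      + now apply jordan_period, Hg.
      + now rewrite Rmult_1_l in H1.
      + replace (g j q - RtoC d * Ci * T)%C with (g j q + RtoC (-1 * d) * Ci * T)%C; [easy|].
        rewrite RtoC_mult, RtoC_m1. ring. }
  (* The exterior side may depend on d. Either the positive side is exterior for arbitrarily small
     d, or it lies in [Om] for all small d and then the negative side is exterior for all of
     them. *)
  destruct (classic (forall dl, 0 < dl -> exists d, 0 < d < dl /\ d < d1 /\
     ~ Om (g j q + RtoC (1 * d) * Ci * T)%C)) as [H|H].
  - exists 1. split; [now left|]. intros dl Hdl. destruct (H dl Hdl) as [d [Hd [Hdd Hout]]].
    exists d. split; [easy|]. apply Hone; [now left|lra|easy].
  - exists (-1). split; [now right|]. apply not_all_ex_not in H. destruct H as [dl0 H].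
    apply imply_to_and in H. destruct H as [Hdl0 H]. intros dl Hdl.
    set (d := Rmin dl (Rmin dl0 d1) / 2).
    assert (N0 : 0 < Rmin dl (Rmin dl0 d1)) by (repeat apply Rmin_glb_lt; easy).
    assert (N1 := Rmin_l dl (Rmin dl0 d1)). assert (N2 := Rmin_r dl (Rmin dl0 d1)).
    assert (N3 := Rmin_l dl0 d1). assert (N4 := Rmin_r dl0 d1).
    assert (Hd : 0 < d) by (unfold d; lra). assert (Hdl' : d < dl) by (unfold d; lra).
    assert (Hdl0' : d < dl0) by (unfold d; lra). assert (Hdd1 : d < d1) by (unfold d; lra).
    exists d. split; [easy|]. apply Hone; [now right|easy|].
    destruct (Htwo d) as [H1|H1]; [easy| |easy].
    exfalso. apply H. exists d. now repeat split.
Qed.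

(** * Analytic parametrisations give Jordan curves *)

Lemma derivable_pt_lim_le f t l : derivable_pt_lim f t l -> forall eps, 0 < eps ->
  exists d, 0 < d /\ forall y, Rabs y < d -> Rabs (f (t + y) - f t - l * y) <= eps * Rabs y.
Proof.
  intros H eps Heps. destruct (H eps Heps) as [[d Hd] Hy]. exists d. split; [easy|].
  intros y Hyd. simpl in Hy. destruct (Req_dec y 0) as [->|Hy0].
  - rewrite Rplus_0_r, Rabs_R0. replace (f t - f t - l * 0) with 0 by ring. rewrite Rabs_R0. lra.
  - specialize (Hy y Hy0 Hyd).
    replace (f (t + y) - f t - l * y) with (((f (t + y) - f t) / y - l) * y) by (field; easy).
    rewrite Rabs_mult. apply Rmult_le_compat_r; [apply Rabs_pos|lra].
Qed.

Lemma Cexpi_tangent t : has_tangent Cexpi t (- sin t, cos t).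
Proof.
  intros eps Heps.
  destruct (derivable_pt_lim_le _ _ _ (derivable_pt_lim_cos t) (eps / 2) ltac:(lra)) as [d1 [Hd1 H1]].
  destruct (derivable_pt_lim_le _ _ _ (derivable_pt_lim_sin t) (eps / 2) ltac:(lra)) as [d2 [Hd2 H2]].
  exists (Rmin d1 d2). split; [now apply Rmin_glb_lt|]. intros y Hy.
  assert (M1 := Rmin_l d1 d2). assert (M2 := Rmin_r d1 d2).
  specialize (H1 y ltac:(lra)). specialize (H2 y ltac:(lra)).
  eapply Rle_trans; [apply Cmod_le_abs|]. unfold Cexpi; simpl.
  replace (cos (t + y) + - cos t + - (- sin t * y - cos t * 0)) with
    (cos (t + y) - cos t - - sin t * y) by ring.
  replace (sin (t + y) + - sin t + - (- sin t * 0 + cos t * y)) with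
    (sin (t + y) - sin t - cos t * y) by ring.
  lra.
Qed.

Lemma has_tangent_comp f g t L T : has_cderiv_at f (g t) L -> has_tangent g t T ->
  has_tangent (fun x => f (g x)) t (L * T)%C.
Proof.
  intros Hf Hg eps Heps.
  assert (HL := Cmod_ge_0 L). assert (HT := Cmod_ge_0 T).
  set (e1 := eps / 2 / (Cmod T + 1)). set (e2 := Rmin 1 (eps / 2 / (Cmod L + 1))).
  assert (He1 : 0 < e1) by (repeat apply Rdiv_lt_0_compat; lra).
  assert (He2' : 0 < eps / 2 / (Cmod L + 1)) by (repeat apply Rdiv_lt_0_compat; lra).
  assert (He2 : 0 < e2) by (apply Rmin_glb_lt; lra).
  assert (M1 : e2 <= 1) by apply Rmin_l. assert (M2 : e2 <= eps / 2 / (Cmod L + 1)) by apply Rmin_r.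
  destruct (Hf e1 He1) as [d1 [Hd1 H1]]. destruct (Hg e2 He2) as [d2 [Hd2 H2]].
  assert (Hq : 0 < d1 / (Cmod T + 1)) by (apply Rdiv_lt_0_compat; lra).
  exists (Rmin d2 (d1 / (Cmod T + 1))). split; [now apply Rmin_glb_lt|]. intros y Hy. toC.
  assert (M3 := Rmin_l d2 (d1 / (Cmod T + 1))). assert (M4 := Rmin_r d2 (d1 / (Cmod T + 1))).
  assert (Hy0 := Rabs_pos y). specialize (H2 y ltac:(lra)).
  set (h := (g (t + y)%R - g t)%C) in *.
  assert (Hh : Cmod h <= (Cmod T + 1) * Rabs y).
  { replace h with ((h - T * RtoC y) + T * RtoC y)%C by ring.
    eapply Rle_trans; [apply Cmod_triangle|]. rewrite Cmod_mult, Cmod_R.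
    assert (e2 * Rabs y <= 1 * Rabs y) by (apply Rmult_le_compat_r; lra). lra. }
  assert (Hhd : Cmod h < d1).
  { eapply Rle_lt_trans; [exact Hh|].
    apply Rlt_le_trans with ((Cmod T + 1) * (d1 / (Cmod T + 1))); [apply Rmult_lt_compat_l; lra|].
    right; field; lra. }
  specialize (H1 h Hhd). replace (g t + h)%C with (g (t + y)) in H1 by (unfold h; ring).
  replace (f (g (t + y)%R) - f (g t) - L * T * RtoC y)%C with
    ((f (g (t + y)%R) - f (g t) - L * h) + L * (h - T * RtoC y))%C by ring.
  eapply Rle_trans; [apply Cmod_triangle|]. rewrite Cmod_mult.
  assert (B1 : e1 * Cmod h <= eps / 2 * Rabs y).
  { apply Rle_trans with (e1 * ((Cmod T + 1) * Rabs y)); [apply Rmult_le_compat_l; lra|].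
    right. unfold e1. field. lra. }
  assert (B2 : Cmod L * Cmod (h - T * RtoC y) <= eps / 2 * Rabs y).
  { apply Rle_trans with ((Cmod L + 1) * (eps / 2 / (Cmod L + 1) * Rabs y)).
    - apply Rmult_le_compat; [lra|apply Cmod_ge_0|lra|].
      eapply Rle_trans; [exact H2|]. apply Rmult_le_compat_r; lra.
    - right. field. lra. }
  lra.
Qed.

Lemma Cexpi_inj q t : q < t < q + 2 * PI -> Cexpi t <> Cexpi q.
Proof.
  intros H E. injection E as E1 E2.
  (* Then 1 - 2 sin^2((t-q)/2) = 1, although the half-angle lies strictly between 0 and PI. *)
  assert (Hc : cos (t - q) = 1).
  { rewrite cos_minus, E1, E2. assert (H' := sin2_cos2 q). unfold Rsqr in H'. lra. }
  replace (t - q) with (2 * ((t - q) / 2)) in Hc by field.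
  rewrite cos_2a_sin in Hc.
  assert (Hs : 0 < sin ((t - q) / 2)) by (apply sin_gt_0; lra).
  assert (0 < sin ((t - q) / 2) * sin ((t - q) / 2)) by now apply Rmult_lt_0_compat. lra.
Qed.

Lemma jordan_curve Phi : analytic_Jordan_param Phi -> jordan (curve Phi).
Proof.
  intros [rho [Rr [H0 [H1 [H2 [Hh Hi]]]]]].
  assert (Ha : forall t, annulus rho Rr (Cexpi t)).
  { intros t. unfold annulus, Cnorm, Cexpi; simpl.
    assert (H := sin2_cos2 t). unfold Rsqr in H.
    replace (cos t * cos t + sin t * sin t) with 1 by lra. rewrite sqrt_1. lra. }
  constructor.
  - intros t. destruct (Hh _ (Ha t)) as [L HL].
    exists (L * (- sin t, cos t)%R)%C. apply (has_tangent_comp Phi Cexpi); [easy|apply Cexpi_tangent].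
  - intros t. unfold curve, Cexpi. now rewrite cos_plus, sin_plus, cos_2PI, sin_2PI, !Rmult_1_r, !Rmult_0_r, Rminus_0_r, Rplus_0_r.
  - intros q t Hqt E. apply (Cexpi_inj q t Hqt). now apply Hi.
Qed.

(** * Dilation differences of a pole *)

Lemma dil_diff_dilate l a f y : dil_diff l (fun x => f (a * x)) y = dil_diff l f (a * y).
Proof.
  revert y. induction l as [|l IH]; intros y; simpl; [easy|].
  rewrite !IH. now replace (a * (2 * y)) with (2 * (a * y)) by ring.
Qed.

Lemma dil_diff_scal l a f y : dil_diff l (fun x => a * f x) y = a * dil_diff l f y.
Proof. revert y. induction l as [|l IH]; intros y; simpl; [easy|]. rewrite !IH. ring. Qed.

Definition lim0 (f : R -> R) (L : R) : Prop :=
  forall eps, 0 < eps -> exists dl, 0 < dl /\ forall d, 0 < d < dl -> Rabs (f d - L) < eps.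

(** Pointwise convergence suffices because only the finitely many points y, 2y, ..., 2^l y are
    read. *)
Lemma lim0_dil_diff (f : R -> R -> R) (f0 : R -> R) : (forall x, lim0 (fun d => f d x) (f0 x)) ->
  forall l y, lim0 (fun d => dil_diff l (f d) y) (dil_diff l f0 y).
Proof.
  intros H. induction l as [|l IH]; intros y; [apply H|]. intros eps Heps. simpl.
  assert (Hp : 0 < 2 ^ l) by (apply pow_lt; lra).
  destruct (IH (2 * y) (eps / 2) ltac:(lra)) as [d1 [Hd1 H1]].
  destruct (IH y (eps / 2 / 2 ^ l)) as [d2 [Hd2 H2]]; [apply Rdiv_lt_0_compat; lra|].
  exists (Rmin d1 d2). split; [now apply Rmin_glb_lt|]. intros d Hd.
  assert (M1 := Rmin_l d1 d2). assert (M2 := Rmin_r d1 d2).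
  specialize (H1 d ltac:(lra)). specialize (H2 d ltac:(lra)).
  replace (dil_diff l (f d) (2 * y) - 2 ^ l * dil_diff l (f d) y -
     (dil_diff l f0 (2 * y) - 2 ^ l * dil_diff l f0 y)) with
    ((dil_diff l (f d) (2 * y) - dil_diff l f0 (2 * y)) +
     2 ^ l * - (dil_diff l (f d) y - dil_diff l f0 y)) by ring.
  eapply Rle_lt_trans; [apply Rabs_triang|].
  rewrite Rabs_mult, Rabs_Ropp, (Rabs_pos_eq (2 ^ l)) by lra.
  assert (2 ^ l * Rabs (dil_diff l (f d) y - dil_diff l f0 y) < 2 ^ l * (eps / 2 / 2 ^ l))
    by (apply Rmult_lt_compat_l; lra).
  replace (2 ^ l * (eps / 2 / 2 ^ l)) with (eps / 2) in * by (field; lra). lra.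
Qed.

Lemma Cinv_nz (z : C) : z <> RtoC 0 -> (/ z)%C <> RtoC 0.
Proof.
  intros H. apply Cmod_gt_0. rewrite Cmod_inv by easy. apply Rinv_0_lt_compat. now apply Cmod_gt_0.
Qed.

(** The product of 1 / (a 2^i y + b) for i = 0, ..., l. *)
Fixpoint pole_prod (a b : C) (l : nat) (y : R) : C :=
  match l with
  | O => (/ (a * RtoC y + b))%C
  | S k => (pole_prod a b k y * / (a * RtoC (2 ^ S k * y) + b))%C
  end.

Lemma pole_prod_S a b l y : pole_prod a b (S l) y = (/ (a * RtoC y + b) * pole_prod a b l (2 * y))%C.
Proof.
  induction l as [|l IH].
  - simpl. now rewrite Rmult_1_r.
  - change (pole_prod a b (S (S l)) y) with
      (pole_prod a b (S l) y * / (a * RtoC (2 ^ S (S l) * y) + b))%C.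
    rewrite IH. change (pole_prod a b (S l) (2 * y)) with
      (pole_prod a b l (2 * y)%R * / (a * RtoC (2 ^ S l * (2 * y)) + b))%C.
    replace (2 ^ S l * (2 * y)) with (2 ^ S (S l) * y) by (simpl; ring). ring.
Qed.

(** Over the common denominator, one more difference leaves (ay + b) - (2^(l+1) ay + b) = (1 -
    2^(l+1)) ay in the numerator, so the power of ay grows by one and the constant is multiplied by
    2^l (1 - 2^(l+1)), which is not 0. *)
Lemma dil_diff_pole a b l : (forall y, a * RtoC y + b <> 0)%C ->
  exists k, k <> 0 /\ forall y,
    (dil_diff l (fun x => fst (/ (a * RtoC x + b))%C) y, dil_diff l (fun x => snd (/ (a * RtoC x + b))%C) y)
    = (RtoC k * Complex.Cpow (a * RtoC y) l * pole_prod a b l y)%C.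
Proof.
  intros Hab. induction l as [|l [k [Hk IH]]].
  - exists 1. split; [lra|]. intros y. cbn [dil_diff pole_prod Complex.Cpow].
    transitivity (/ (a * RtoC y + b))%C; [symmetry; apply surjective_pairing|C_eq; ring].
  - exists (k * 2 ^ l * (1 - 2 ^ S l)). split.
    { assert (1 < 2 ^ S l) by (apply Rlt_pow_R1; [lra|lia]).
      repeat apply Rmult_integral_contrapositive_currified; [easy|apply pow_nonzero; lra|lra]. }
    intros y.
    assert (E : forall u v : R -> R,
      (dil_diff (S l) u y, dil_diff (S l) v y) =
      ((dil_diff l u (2 * y)%R, dil_diff l v (2 * y)%R) - RtoC (2 ^ l) * (dil_diff l u y, dil_diff l v y))%C).
    { intros u v. unfold Cminus, Cplus, Copp, Cmult; simpl. f_equal; ring. }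
    rewrite E, !IH.
    assert (E1 : pole_prod a b l (2 * y) = ((a * RtoC y + b) * pole_prod a b (S l) y)%C).
    { rewrite pole_prod_S. field. apply Hab. }
    assert (E2 : pole_prod a b l y = ((a * RtoC (2 ^ S l * y) + b) * pole_prod a b (S l) y)%C).
    { change (pole_prod a b (S l) y) with (pole_prod a b l y * / (a * RtoC (2 ^ S l * y)%R + b))%C.
      generalize (Hab (2 ^ S l * y)). generalize (2 ^ S l * y). intros Y HY. field. exact HY. }
    rewrite E1, E2. clear E1 E2.
    replace (a * RtoC (2 * y))%C with (RtoC 2 * (a * RtoC y))%C by (rewrite RtoC_mult; ring).
    rewrite Cpow_mult_l, <- RtoC_pow, !RtoC_mult, RtoC_minus.
    simpl Complex.Cpow. C_eq. ring.
Qed.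

Lemma dil_diff_pole_neq_0 a b l : a <> RtoC 0 -> (forall y, a * RtoC y + b <> 0)%C ->
  ~ (dil_diff l (fun x => fst (/ (a * RtoC x + b))%C) 1 = 0 /\
     dil_diff l (fun x => snd (/ (a * RtoC x + b))%C) 1 = 0).
Proof.
  intros Ha Hab [H1 H2]. destruct (dil_diff_pole a b l Hab) as [k [Hk H]].
  specialize (H 1). rewrite H1, H2 in H.
  assert (Hp : forall y, pole_prod a b l y <> RtoC 0).
  { clear -Hab. induction l as [|l IH]; intros y; simpl.
    - apply Cinv_nz, Hab.
    - apply Cmult_neq_0; [apply IH|]. apply Cinv_nz, (Hab (2 ^ S l * y)). }
  assert (Hne : (RtoC k * Complex.Cpow (a * RtoC 1) l * pole_prod a b l 1)%C <> RtoC 0).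
  { apply Cmult_neq_0; [apply Cmult_neq_0|apply Hp].
    - intros E. apply Hk. now injection E.
    - apply Cpow_nz. rewrite Cmult_1_r. exact Ha. }
  apply Hne. symmetry. exact H.
Qed.

(** * Baire category argument *)

Lemma lim0_component (p : C -> R) (u : R -> C) L :
  (forall a b, p (a - b)%C = p a - p b) -> (forall w, Rabs (p w) <= Cmod w) ->
  (forall eps, 0 < eps -> exists dl, 0 < dl /\ forall d, 0 < d < dl -> Cmod (u d - L) < eps) ->
  lim0 (fun d => p (u d)) (p L).
Proof.
  intros Hm Hb H eps Heps. destruct (H eps Heps) as [dl [Hdl Hd]].
  exists dl. split; [easy|]. intros d Hdd. rewrite <- Hm.
  eapply Rle_lt_trans; [apply Hb|now apply Hd].
Qed.

Lemma rescaled_pole_limit g q T b x : has_tangent g q T -> (T * RtoC x + b)%C <> RtoC 0 ->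
  forall eps, 0 < eps -> exists dl, 0 < dl /\ forall d, 0 < d < dl ->
    Cmod (/ ((g (q + d * x)%R - g q) / RtoC d + b) - / (T * RtoC x + b))%C < eps.
Proof.
  intros Ht Hp eps Heps.
  destruct (has_cderiv_at_cont _ _ _ (has_cderiv_at_inv_minus (RtoC 0) _ Hp) eps Heps)
    as [eta [Heta Hc]].
  assert (Hx := Rabs_pos x).
  assert (He : 0 < eta / (Rabs x + 1)) by (apply Rdiv_lt_0_compat; lra).
  destruct (Ht _ He) as [d1 [Hd1 H1]].
  assert (Hd : 0 < d1 / (Rabs x + 1)) by (apply Rdiv_lt_0_compat; lra).
  exists (d1 / (Rabs x + 1)). split; [easy|]. intros d [Hd0 Hdl].
  assert (Hdx : Rabs (d * x) = d * Rabs x) by (rewrite Rabs_mult, (Rabs_pos_eq d); lra).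
  specialize (H1 (d * x)). rewrite Hdx in H1.
  assert (Hlt : d * Rabs x < d1).
  { apply Rle_lt_trans with (d * (Rabs x + 1)); [apply Rmult_le_compat_l; lra|].
    apply Rlt_le_trans with (d1 / (Rabs x + 1) * (Rabs x + 1)); [apply Rmult_lt_compat_r; lra|].
    right; field; lra. }
  specialize (H1 Hlt).
  assert (Hdn : RtoC d <> RtoC 0) by (intros E; injection E; lra).
  specialize (Hc ((g (q + d * x)%R - g q) / RtoC d + b)%C). cbv beta in Hc.
  assert (E0 : forall z : C, (z - RtoC 0)%C = z) by (intros; ring). rewrite !E0 in Hc.
  apply Hc.
  replace ((g (q + d * x)%R - g q) / RtoC d + b - (T * RtoC x + b))%C with
    ((g (q + d * x)%R - g q - T * RtoC (d * x)) / RtoC d)%C by (rewrite RtoC_mult; field; easy).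
  rewrite Cmod_div, Cmod_R, (Rabs_pos_eq d) by (easy || lra).
  apply Rmult_lt_reg_r with d; [easy|]. unfold Rdiv at 1. rewrite Rmult_assoc, Rinv_l, Rmult_1_r by lra.
  eapply Rle_lt_trans; [exact H1|].
  replace (eta / (Rabs x + 1) * (d * Rabs x)) with (eta * d * (Rabs x / (Rabs x + 1))) by (field; lra).
  rewrite <- (Rmult_1_r (eta * d)) at 2. apply Rmult_lt_compat_l; [now apply Rmult_lt_0_compat|].
  apply Rmult_lt_reg_r with (Rabs x + 1); [lra|]. unfold Rdiv.
  rewrite Rmult_assoc, Rinv_l, Rmult_1_r by lra. lra.
Qed.

(** A pole of strength c1 d^(n+1) at distance k0 d has derivatives up to order n bounded
    independently of d. The base 1 + 1/k0 is at least 1, so its exponent may be raised from l + 1 to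
    n + 1. *)
Lemma pole_tower_small c1 d k0 l n : 0 <= c1 -> 0 < d <= 1 -> 0 < k0 -> (l <= n)%nat ->
  c1 * d ^ S n * INR (fact l) * (/ (k0 * d)) ^ S l <= c1 * (INR (fact n) * (1 + / k0) ^ S n).
Proof.
  intros Hc Hd Hk Hl. assert (Hki := Rinv_0_lt_compat _ Hk).
  assert (Hf : 0 <= INR (fact l) <= INR (fact n)).
  { split; [apply pos_INR|apply le_INR, fact_le, Hl]. }
  assert (Hdd : d ^ S n * (/ d) ^ S l <= 1).
  { replace (S n) with ((n - l) + S l)%nat by lia. rewrite pow_add, Rmult_assoc, <- Rpow_mult_distr.
    rewrite Rinv_r, pow1, Rmult_1_r by lra. rewrite <- (pow1 (n - l)). apply pow_incr. lra. }
  assert (Hdd0 : 0 <= d ^ S n * (/ d) ^ S l).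
  { apply Rmult_le_pos; apply pow_le; [lra|]. left. apply Rinv_0_lt_compat. lra. }
  assert (Hkk : 0 <= (/ k0) ^ S l <= (1 + / k0) ^ S n).
  { split; [apply pow_le; lra|]. apply Rle_trans with ((1 + / k0) ^ S l).
    - apply pow_incr. lra.
    - apply Rle_pow; [lra|lia]. }
  rewrite Rinv_mult, Rpow_mult_distr.
  replace (c1 * d ^ S n * INR (fact l) * ((/ k0) ^ S l * (/ d) ^ S l)) with
    (c1 * ((INR (fact l) * (/ k0) ^ S l) * (d ^ S n * (/ d) ^ S l))) by ring.
  apply Rmult_le_compat_l; [easy|].
  rewrite <- (Rmult_1_r (INR (fact n) * (1 + / k0) ^ S n)).
  apply Rmult_le_compat; [apply Rmult_le_pos; lra|easy| |easy].
  apply Rmult_le_compat; lra.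
Qed.

(* If F + pole satisfied the bounds for poles w approaching g q, the dilation differences of the
   rescaled poles would tend to 0, whereas they tend to those of x |-> 1 / (T (x - sg i)). *)
Lemma escape Om F g q T sg K N0 eps :
  smooth_tower Om F -> (forall t, closure Om (g t)) -> T <> RtoC 0 -> has_tangent g q T ->
  (sg = 1 \/ sg = -1) ->
  (forall dl, 0 < dl -> exists d, 0 < d < dl /\
    forall z, closure Om z -> Cmod T * d / 2 <= Cmod (z - (g q + RtoC (sg * d) * Ci * T))%C) ->
  0 < K -> 0 < eps ->
  exists F', smooth_tower Om F' /\
    (forall l z, (l <= N0)%nat -> closure Om z -> Cmod (F' l z - F l z) <= eps) /\
    ~ (taylor_bound q K (fun t => fst (F' O (g t))) /\ taylor_bound q K (fun t => snd (F' O (g t)))).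
Proof.
  intros HF Hg HT Ht Hsg Hext HK Heps.
  destruct (classic (taylor_bound q K (fun t => fst (F O (g t))) /\
    taylor_bound q K (fun t => snd (F O (g t))))) as [[B1 B2]|HB].
  2:{ exists F. split; [easy|]. split; [|easy]. intros l z _ _. toC.
      replace (F l z - F l z)%C with (RtoC 0) by ring. rewrite Cmod_0. lra. }
  (* From here on every tower within eps of F up to order N0 satisfies both bounds; the poles will
     refute this. *)
  apply NNPP. intros Hn.
  assert (HTp : 0 < Cmod T) by now apply Cmod_gt_0.
  set (k0 := Cmod T / 2). assert (Hk0 : 0 < k0) by (unfold k0; lra).
  assert (Hki := Rinv_0_lt_compat _ Hk0).
  set (A := INR (fact N0) * (1 + / k0) ^ S N0).
  assert (HA : 0 < A).
  { apply Rmult_lt_0_compat; [apply INR_fact_lt_0|apply pow_lt; lra]. }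
  (* Makes the bound c1 A of [pole_tower_small] equal to eps. *)
  set (c1 := eps / A). assert (Hc1 : 0 < c1) by (apply Rdiv_lt_0_compat; lra).
  set (l := S N0). set (b := (- (RtoC sg * Ci * T))%C).
  set (M := dil_const l * (2 * K ^ S l * (2 ^ l) ^ l)).
  assert (HM : 0 < M).
  { apply Rmult_lt_0_compat; [apply dil_const_pos|].
    repeat apply Rmult_lt_0_compat; try apply pow_lt; try apply pow_lt; lra. }
  assert (H2l : 0 < 2 ^ l) by (apply pow_lt; lra).
  (* This is d / (g(q + dx) - w) for the pole w = g(q) + sg d i T, written so that its limit as d ->
     0 is visible. *)
  set (v := fun d x => (/ ((g (q + d * x)%R - g q) / RtoC d + b))%C).
  assert (Hsmall : forall d, 0 < d <= 1 -> 2 ^ l * d < / K ->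
    (forall z, closure Om z -> Cmod T * d / 2 <= Cmod (z - (g q + RtoC (sg * d) * Ci * T))%C) ->
    Rabs (dil_diff l (fun x => fst (v d x)) 1) <= M / c1 * d /\
    Rabs (dil_diff l (fun x => snd (v d x)) 1) <= M / c1 * d).
  { intros d Hd HdK Hdext.
    set (w := (g q + RtoC (sg * d) * Ci * T)%C) in *.
    set (F' := fun n z => Cplus (F n z) (pole_tower (c1 * d ^ l) w n z)).
    assert (Hdl : 0 < d ^ l) by (apply pow_lt; lra).
    assert (Hdn : RtoC d <> RtoC 0) by (intros E; injection E; lra).
    assert (Hr : 0 < k0 * d) by (apply Rmult_lt_0_compat; lra).
    assert (Hdext' : forall z, closure Om z -> k0 * d <= Cmod (z - w)).
    { intros z Hz. specialize (Hdext z Hz). unfold k0. lra. }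
    assert (HF' : smooth_tower Om F') by now apply (smooth_tower_plus_pole Om F _ w (k0 * d)).
    assert (HTB : taylor_bound q K (fun t => fst (F' O (g t))) /\
                  taylor_bound q K (fun t => snd (F' O (g t)))).
    { apply NNPP. intros Hn'. apply Hn. exists F'. split; [easy|]. split; [|easy].
      intros n z Hnl Hz. unfold F'. toC.
      replace (F n z + pole_tower (c1 * d ^ l) w n z - F n z)%C with (pole_tower (c1 * d ^ l) w n z) by ring.
      eapply Rle_trans; [apply (Cmod_pole_tower _ _ _ _ (k0 * d)); [|easy|now apply Hdext']|].
      - left. now apply Rmult_lt_0_compat.
      - eapply Rle_trans; [apply (pole_tower_small c1 d k0 n N0); try easy; lra|].
        fold A. right. unfold c1. field. lra. }
    assert (Hpole : forall x, pole_tower (c1 * d ^ l) w O (g (q + d * x)) = (RtoC (c1 * d ^ N0) * v d x)%C).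
    { intros x. unfold pole_tower, v.
      assert (Hnz : (g (q + d * x)%R - w <> 0)%C).
      { apply Cmod_gt_0. specialize (Hdext' _ (Hg (q + d * x))). lra. }
      assert (E : (g (q + d * x)%R - w = RtoC d * ((g (q + d * x)%R - g q) / RtoC d + b))%C).
      { unfold w, b. rewrite RtoC_mult. field. easy. }
      rewrite E in Hnz |- *.
      assert (Hnz2 : ((g (q + d * x)%R - g q) / RtoC d + b <> 0)%C).
      { intros E'. apply Hnz. rewrite E'. ring. }
      replace (c1 * d ^ l * ((-1) ^ 0 * INR (fact 0))) with ((c1 * d ^ N0) * d) by (unfold l; simpl; ring).
      rewrite (RtoC_mult _ d). generalize dependent ((g (q + d * x)%R - g q) / RtoC d + b)%C.
      intros z _ _ Hz. simpl Complex.Cpow. field. now split. }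
    assert (HdK' : 2 ^ l * Rabs d < / K) by (rewrite Rabs_pos_eq; lra).
    assert (Hfin : forall p : C -> R, (forall z1 z2, p (z1 + z2)%C - p z1 = p z2) ->
      (forall k z, p (RtoC k * z)%C = k * p z) ->
      taylor_bound q K (fun t => p (F O (g t))) -> taylor_bound q K (fun t => p (F' O (g t))) ->
      Rabs (dil_diff l (fun x => p (v d x)) 1) <= M / c1 * d).
    { intros p Hp1 Hp2 T1 T2.
      assert (H := taylor_bound_dil_diff q K l _ _ d HK T1 T2 HdK').
      (* The difference at d becomes one at 1 of the dilated function c1 d^N0 v; comparing c1 d^N0
         with M d^(N0+1) leaves a factor d. *)
      fold M in H. rewrite (Rabs_pos_eq d) in H by lra. rewrite <- (Rmult_1_r d) in H at 1.
      rewrite <- (dil_diff_dilate l d (fun x => p (F' O (g (q + x))) - p (F O (g (q + x))))) in H.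
      rewrite (dil_diff_ext _ _ (fun x => (c1 * d ^ N0) * p (v d x))) in H.
      2:{ intros x. unfold F'. now rewrite Hp1, Hpole, Hp2. }
      assert (Hcd : 0 < c1 * d ^ N0) by (apply Rmult_lt_0_compat; [easy|apply pow_lt; lra]).
      rewrite dil_diff_scal, Rabs_mult, (Rabs_pos_eq (c1 * d ^ N0)) in H by lra.
      apply Rmult_le_reg_l with (c1 * d ^ N0); [easy|].
      eapply Rle_trans; [exact H|]. right. unfold l. simpl. field. lra. }
    destruct HTB as [T1 T2]. split.
    - apply (Hfin fst); [intros; simpl; ring|intros; simpl; ring|easy|easy].
    - apply (Hfin snd); [intros; simpl; ring|intros; simpl; ring|easy|easy]. }
  assert (Hb : forall y, (T * RtoC y + b <> 0)%C).
  { intros y E. replace (T * RtoC y + b)%C with (T * (RtoC y - RtoC sg * Ci))%C in E by (unfold b; ring).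
    assert (E' : (RtoC y - RtoC sg * Ci)%C = RtoC 0).
    { apply NNPP. intros Hne. now apply (Cmult_neq_0 T _ HT Hne). }
    apply (f_equal snd) in E'. simpl in E'. destruct Hsg; lra. }
  assert (Hlim : forall (p : C -> R), (forall z1 z2, p (z1 - z2)%C = p z1 - p z2) ->
    (forall z, Rabs (p z) <= Cmod z) ->
    (forall d, 0 < d <= 1 -> 2 ^ l * d < / K ->
      (forall z, closure Om z -> Cmod T * d / 2 <= Cmod (z - (g q + RtoC (sg * d) * Ci * T))%C) ->
      Rabs (dil_diff l (fun x => p (v d x)) 1) <= M / c1 * d) ->
    dil_diff l (fun x => p (/ (T * RtoC x + b))%C) 1 = 0).
  { intros p Hp1 Hp2 Hp3.
    assert (Hl0 : lim0 (fun d => dil_diff l (fun x => p (v d x)) 1) (dil_diff l (fun x => p (/ (T * RtoC x + b))%C) 1)).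
    { apply (lim0_dil_diff (fun d x => p (v d x))). intros x.
      apply lim0_component; [easy|easy|]. now apply rescaled_pole_limit. }
    set (L := dil_diff l (fun x => p (/ (T * RtoC x + b))%C) 1) in *.
    apply NNPP. intros HL. assert (HLp := Rabs_pos_lt L HL).
    destruct (Hl0 (Rabs L / 2) ltac:(lra)) as [d1 [Hd1 H1]].
    assert (HKi := Rinv_0_lt_compat _ HK).
    assert (Q1 : 0 < / K / 2 ^ l) by (apply Rdiv_lt_0_compat; lra).
    assert (HMc : 0 < M / c1) by (apply Rdiv_lt_0_compat; lra).
    assert (Q2 : 0 < Rabs L / 2 / (M / c1)) by (apply Rdiv_lt_0_compat; lra).
    destruct (Hext (Rmin (Rmin d1 1) (Rmin (/ K / 2 ^ l) (Rabs L / 2 / (M / c1)))))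
      as [d [[Hd0 Hd] Hde]]; [repeat apply Rmin_glb_lt; lra|].
    assert (R1 := Rmin_l (Rmin d1 1) (Rmin (/ K / 2 ^ l) (Rabs L / 2 / (M / c1)))).
    assert (R2 := Rmin_r (Rmin d1 1) (Rmin (/ K / 2 ^ l) (Rabs L / 2 / (M / c1)))).
    assert (R3 := Rmin_l d1 1). assert (R4 := Rmin_r d1 1).
    assert (R5 := Rmin_l (/ K / 2 ^ l) (Rabs L / 2 / (M / c1))).
    assert (R6 := Rmin_r (/ K / 2 ^ l) (Rabs L / 2 / (M / c1))).
    assert (HdK : 2 ^ l * d < / K).
    { apply Rlt_le_trans with (2 ^ l * (/ K / 2 ^ l)); [apply Rmult_lt_compat_l; lra|].
      right. field. lra. }
    assert (HdM : M / c1 * d < Rabs L / 2).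
    { apply Rlt_le_trans with (M / c1 * (Rabs L / 2 / (M / c1))); [apply Rmult_lt_compat_l; lra|].
      right. field. lra. }
    specialize (Hp3 d ltac:(lra) HdK Hde). specialize (H1 d ltac:(lra)).
    assert (Htri := Rabs_triang_inv L (dil_diff l (fun x => p (v d x)) 1)).
    rewrite Rabs_minus_sym in H1. lra. }
  apply (dil_diff_pole_neq_0 T b l HT Hb). split.
  - apply (Hlim fst); [easy|apply fst_le_Cmod|]. intros; now apply Hsmall.
  - apply (Hlim snd); [easy|apply snd_le_Cmod|]. intros; now apply Hsmall.
Qed.

(** Stage n moves the tower off [Bad n], changing derivatives up to order max(N0, n) by at most half
    of the current radius, and then shrinks the radius until every function that close on the
    closure avoids [Bad n]. The limit stays within the radius of each stage. *)
Lemma baire_smooth_tower Om (Bad : nat -> (C -> C) -> Prop) : open_set Om ->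
  (forall n F N0 eps, smooth_tower Om F -> 0 < eps -> exists F', smooth_tower Om F' /\
    (forall l z, (l <= N0)%nat -> closure Om z -> Cmod (F' l z - F l z) <= eps) /\ ~ Bad n (F' O)) ->
  (forall n F, ~ Bad n F -> exists rho, 0 < rho /\
    forall G, (forall z, closure Om z -> Cmod (G z - F z) <= rho) -> ~ Bad n G) ->
  forall F N0 eps, smooth_tower Om F -> 0 < eps -> exists F', smooth_tower Om F' /\
    (forall l z, (l <= N0)%nat -> closure Om z -> Cmod (F' l z - F l z) <= eps) /\
    forall n, ~ Bad n (F' O).
Proof.
  intros Ho Hesc Hstab F N0 eps HF Heps.
  set (good := fun p : (nat -> C -> C) * R => smooth_tower Om (fst p) /\ 0 < snd p).
  assert (Hstep : forall x : nat * ((nat -> C -> C) * R), exists p', good (snd x) ->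
    good p' /\ snd p' <= snd (snd x) / 2 /\
    (forall l z, (l <= max N0 (fst x))%nat -> closure Om z ->
       Cmod (fst p' l z - fst (snd x) l z) <= snd (snd x) / 2) /\
    forall G, (forall z, closure Om z -> Cmod (G z - fst p' O z) <= snd p') -> ~ Bad (fst x) G).
  { intros [n [T r]]. unfold good. simpl.
    destruct (classic (smooth_tower Om T /\ 0 < r)) as [[HT Hr]|H]; [|exists (T, r); tauto].
    destruct (Hesc n T (max N0 n) (r / 2) HT ltac:(lra)) as [T' [HT' [Hcl Hbad]]].
    destruct (Hstab n (T' O) Hbad) as [rho [Hrho HG]].
    exists (T', Rmin (r / 2) rho). intros _. simpl.
    assert (M1 := Rmin_l (r / 2) rho). assert (M2 := Rmin_r (r / 2) rho).
    repeat split; try apply HT'; try easy.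
    - apply Rmin_glb_lt; lra.
    - intros G HGz. apply HG. intros z Hz. specialize (HGz z Hz). lra. }
  destruct (functional_choice _ Hstep) as [step Hs].
  set (st := fix st n := match n with O => (F, eps) | S k => step (k, st k) end).
  assert (Hgood : forall n, good (st n)).
  { induction n as [|n IH]; [split; easy|]. apply (Hs (n, st n) IH). }
  assert (Hst : forall n, _) by exact (fun n => proj2 (Hs (n, st n) (Hgood n))).
  destruct (smooth_tower_limit Om N0 (fun n => fst (st n)) (fun n => snd (st n))) as [F' [HF' Hcl]].
  - easy.
  - intros k. apply Hgood.
  - intros k. apply Hgood.
  - intros k. apply (Hst k).
  - intros k l z Hl Hz. exact (proj1 (proj2 (Hst k)) l z Hl Hz).
  - exists F'. split; [easy|]. split.
    + intros l z Hl Hz. apply (Hcl O l z); [lia|easy].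
    (* [Bad n] is left on passing to stage n + 1, so the radius of that stage counts. *)
    + intros n. apply (proj2 (proj2 (Hst n))). intros z Hz. apply (Hcl (S n) O z); [lia|easy].
Qed.

Definition curve_bound (q K : R) (g : R -> C) (F : C -> C) : Prop :=
  taylor_bound q K (fun t => fst (F (g t))) /\ taylor_bound q K (fun t => snd (F (g t))).

(** Contrapositive of [taylor_bound_closed] for the two components. *)
Lemma curve_bound_stable Om q K g F : 0 < K -> (forall t, closure Om (g t)) -> ~ curve_bound q K g F ->
  exists rho, 0 < rho /\
    forall G, (forall z, closure Om z -> Cmod (G z - F z) <= rho) -> ~ curve_bound q K g G.
Proof.
  intros HK Hg HF. apply NNPP. intros Hn. apply HF.
  assert (H : forall eps, 0 < eps -> exists G, curve_bound q K g G /\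
    forall z, closure Om z -> Cmod (G z - F z) <= eps).
  { intros eps Heps. apply NNPP. intros H. apply Hn. exists eps. split; [easy|].
    intros G HG HB. apply H. now exists G. }
  split; apply taylor_bound_closed; try easy; intros eps Heps;
    destruct (H eps Heps) as [G [[G1 G2] HG]].
  - exists (fun t => fst (G (g t))). split; [easy|]. intros y _. rewrite Rabs_minus_sym.
    eapply Rle_trans; [|apply (HG _ (Hg (q + y)))]. apply (fst_le_Cmod (G (g (q + y)%R) - F (g (q + y)%R))%C).
  - exists (fun t => snd (G (g t))). split; [easy|]. intros y _. rewrite Rabs_minus_sym.
    eapply Rle_trans; [|apply (HG _ (Hg (q + y)))]. apply (snd_le_Cmod (G (g (q + y)%R) - F (g (q + y)%R))%C).
Qed.

(** * Real analyticity on a curve in terms of the Taylor bounds *)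

Lemma Cpartial_sum_n u n : Cpartial u n = (sum_n (fun k => fst (u k)) n, sum_n (fun k => snd (u k)) n).
Proof.
  induction n as [|n IH]; simpl.
  - rewrite !sum_O. apply surjective_pairing.
  - rewrite IH, !sum_Sn. reflexivity.
Qed.

Lemma is_lim_seq_eps (u : nat -> R) (l : R) : is_lim_seq u l <->
  forall eps, 0 < eps -> exists N, forall n, (N <= n)%nat -> Rabs (u n - l) < eps.
Proof.
  rewrite <- is_lim_seq_spec. split.
  - intros H eps Heps. exact (H (mkposreal eps Heps)).
  - intros H eps. exact (H eps (cond_pos eps)).
Qed.

Lemma Cseries_cv_components u l : Cseries_cv u l <->
  is_series (fun k => fst (u k)) (fst l) /\ is_series (fun k => snd (u k)) (snd l).
Proof.
  assert (E : forall n, Csub (Cpartial u n) l =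
    (sum_n (fun k => fst (u k)) n - fst l, sum_n (fun k => snd (u k)) n - snd l)).
  { intros n. now rewrite Cpartial_sum_n. }
  split.
  - intros H. split; apply is_lim_seq_eps; intros eps Heps; destruct (H eps Heps) as [N HN];
      exists N; intros n Hn; specialize (HN n Hn); rewrite Cnorm_Cmod, E in HN.
    + exact (Rle_lt_trans _ _ _ (fst_le_Cmod _) HN).
    + exact (Rle_lt_trans _ _ _ (snd_le_Cmod _) HN).
  - intros [H1 H2] eps Heps.
    destruct (proj1 (is_lim_seq_eps _ _) H1 (eps / 2) ltac:(lra)) as [N1 HN1].
    destruct (proj1 (is_lim_seq_eps _ _) H2 (eps / 2) ltac:(lra)) as [N2 HN2].
    exists (max N1 N2). intros n Hn. specialize (HN1 n ltac:(lia)). specialize (HN2 n ltac:(lia)).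
    rewrite Cnorm_Cmod, E. eapply Rle_lt_trans; [apply Cmod_le_abs|]. apply Rlt_le_trans with (eps / 2 + eps / 2); [exact (Rplus_lt_compat _ _ _ _ HN1 HN2)|lra].
Qed.

Lemma Cpow_RtoC y n : Defs.Cpow (Defs.RtoC y) n = (y ^ n, 0).
Proof.
  induction n as [|n IH]; [easy|]. change (Defs.Cpow (Defs.RtoC y) (S n)) with
    (Cmul (Defs.RtoC y) (Defs.Cpow (Defs.RtoC y) n)).
  rewrite IH. unfold Cmul, Defs.RtoC; simpl. f_equal; ring.
Qed.

Lemma real_analytic_components F g t0 : real_analytic_at_on_curve F g t0 <->
  exists a1 a2 dl, 0 < dl /\ power_series_at (fun t => fst (F (g t))) t0 dl a1 /\
    power_series_at (fun t => snd (F (g t))) t0 dl a2.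
Proof.
  assert (E : forall (a : nat -> C) y k, Cmul (a k) (Defs.Cpow (Defs.RtoC y) k) =
    (fst (a k) * y ^ k, snd (a k) * y ^ k)).
  { intros a y k. rewrite Cpow_RtoC. unfold Cmul; simpl. f_equal; ring. }
  split.
  - intros [a [dl [Hdl H]]]. exists (fun k => fst (a k)), (fun k => snd (a k)), dl.
    split; [easy|]. split; intros t Ht; apply Rabs_lt_between' in Ht;
      specialize (H t Ht); apply Cseries_cv_components in H; destruct H as [H1 H2].
    + refine (is_series_ext _ _ _ _ H1). intros k. exact (f_equal fst (E a (t - t0) k)).
    + refine (is_series_ext _ _ _ _ H2). intros k. exact (f_equal snd (E a (t - t0) k)).
  - intros [a1 [a2 [dl [Hdl [H1 H2]]]]]. exists (fun k => (a1 k, a2 k)), dl. split; [easy|].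
    intros t Ht. apply Cseries_cv_components. apply Rabs_lt_between' in Ht. split.
    + refine (is_series_ext _ _ _ _ (H1 t Ht)). intros k.
      symmetry. exact (f_equal fst (E (fun k => (a1 k, a2 k)) (t - t0) k)).
    + refine (is_series_ext _ _ _ _ (H2 t Ht)). intros k.
      symmetry. exact (f_equal snd (E (fun k => (a1 k, a2 k)) (t - t0) k)).
Qed.

Lemma curve_bound_real_analytic q K g F : 0 < K -> curve_bound q K g F ->
  real_analytic_at_on_curve F g q.
Proof.
  intros HK [H1 H2]. apply real_analytic_components.
  destruct (taylor_bound_series _ _ _ HK H1) as [a1 Ha1].
  destruct (taylor_bound_series _ _ _ HK H2) as [a2 Ha2].
  exists a1, a2, (/ K). split; [now apply Rinv_0_lt_compat|easy].
Qed.

Lemma real_analytic_curve_bound t0 g F : real_analytic_at_on_curve F g t0 ->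
  exists dl K0, 0 < dl /\ forall q, Rabs (q - t0) <= dl -> forall K, K0 <= K -> curve_bound q K g F.
Proof.
  intros H. apply real_analytic_components in H. destruct H as [a1 [a2 [dl [Hdl [H1 H2]]]]].
  destruct (taylor_bound_near _ _ _ _ Hdl H1) as [K1 [HK1 B1]].
  destruct (taylor_bound_near _ _ _ _ Hdl H2) as [K2 [HK2 B2]].
  exists (dl / 8), (Rmax K1 K2). split; [lra|]. intros q Hq K HK.
  assert (M1 := Rmax_l K1 K2). assert (M2 := Rmax_r K1 K2). split; [apply B1|apply B2]; lra.
Qed.

(** All rationals, coded by three naturals; c also fixes the mesh 1/(c+1) within which a centre may
    be moved. *)
Definition grid (a b c : nat) : R := (INR a - INR b) / INR (S c).

(** Density in a form that survives moving the grid point to a regular parameter at distance at most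
    one mesh. *)
Lemma grid_dense t0 dl : 0 < dl -> exists a b c,
  forall q, Rabs (q - grid a b c) <= / INR (S c) -> Rabs (q - t0) <= dl.
Proof.
  intros Hdl. destruct (archimed_cor1 (dl / 2) ltac:(lra)) as [[|c] [Hc Hc0]]; [lia|].
  assert (Hp : 0 < INR (S c)) by (apply lt_0_INR; lia).
  set (z := up (t0 * INR (S c))). destruct (archimed (t0 * INR (S c))) as [H1 H2]. fold z in H1, H2.
  exists (Z.to_nat z), (Z.to_nat (- z)), c. intros q Hq.
  assert (Ez : INR (Z.to_nat z) - INR (Z.to_nat (- z)) = IZR z).
  { destruct (Z.le_gt_cases 0 z).
    - rewrite !INR_IZR_INZ, Z2Nat.id by lia. replace (Z.to_nat (- z)) with O by lia. simpl; ring.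
    - rewrite !INR_IZR_INZ, (Z2Nat.id (- z)) by lia. replace (Z.to_nat z) with O by lia.
      rewrite opp_IZR. simpl; ring. }
  unfold grid in Hq. rewrite Ez in Hq.
  assert (Hg : Rabs (IZR z / INR (S c) - t0) <= / INR (S c)).
  { replace (IZR z / INR (S c) - t0) with ((IZR z - t0 * INR (S c)) * / INR (S c)) by (field; lra).
    rewrite Rabs_mult, (Rabs_pos_eq (/ INR (S c))) by (left; now apply Rinv_0_lt_compat).
    rewrite <- (Rmult_1_l (/ INR (S c))) at 2.
    apply Rmult_le_compat_r; [left; now apply Rinv_0_lt_compat|]. rewrite Rabs_pos_eq; lra. }
  replace (q - t0) with ((q - IZR z / INR (S c)) + (IZR z / INR (S c) - t0)) by ring.
  eapply Rle_trans; [apply Rabs_triang|]. lra.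
Qed.

Lemma jordan_regular_points g : jordan g -> forall x : nat * nat * nat,
  exists q, Rabs (q - grid (fst (fst x)) (snd (fst x)) (snd x)) <= / INR (S (snd x)) /\
    exists T, T <> RtoC 0 /\ has_tangent g q T.
Proof.
  intros Hg [[a b] c]. cbn [fst snd].
  assert (Hp : 0 < / INR (S c)) by (apply Rinv_0_lt_compat, lt_0_INR; lia).
  destruct (jordan_tangent_dense g (grid a b c - / INR (S c)) (grid a b c + / INR (S c)) Hg)
    as [q [T [Hq HT]]]; [lra|].
  exists q. split; [apply Rabs_le_between'; lra|now exists T].
Qed.

Theorem theorem5p18 (Om : Cpx -> Prop) (m : nat) (Phi : nat -> Cpx -> Cpx) :
  domain Om -> bounded_set Om ->
  (forall j, (j < m)%nat -> analytic_Jordan_param (Phi j)) ->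
  (forall j k, (j < m)%nat -> (k < m)%nat -> j <> k ->
     forall s t, curve (Phi j) s <> curve (Phi k) t) ->
  (forall z, boundary Om z <-> exists j t, (j < m)%nat /\ z = curve (Phi j) t) ->
  A_dense Om (nowhere_RA_on_boundary Om m Phi) /\
  A_Gdelta Om (nowhere_RA_on_boundary Om m Phi).
Proof.
  intros [Ho [Hc _]] _ HPhi Hdisj Hbd.
  assert (HJ : forall j, (j < m)%nat -> jordan (curve (Phi j))) by (intros; now apply jordan_curve, HPhi).
  assert (Hb : forall j t, (j < m)%nat -> boundary Om (curve (Phi j) t)).
  { intros j t Hj. apply Hbd. now exists j, t. }
  assert (Hcl : forall j t, (j < m)%nat -> closure Om (curve (Phi j) t)) by (intros; now apply Hb).
  assert (HnOm : forall j t, (j < m)%nat -> ~ Om (curve (Phi j) t)).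
  { intros j t Hj H. apply (proj2 (Hb j t Hj)). now apply Ho. }
  (* The choice of centres must be total, so indices j >= m receive the dummy centre 0. *)
  assert (Hreg : forall y : nat * (nat * nat * nat), exists q, (fst y < m)%nat ->
    Rabs (q - grid (fst (fst (snd y))) (snd (fst (snd y))) (snd (snd y))) <= / INR (S (snd (snd y))) /\
    exists T, T <> RtoC 0 /\ has_tangent (curve (Phi (fst y))) q T).
  { intros [j x]. destruct (Nat.lt_ge_cases j m) as [Hj|Hj].
    - destruct (jordan_regular_points _ (HJ j Hj) x) as [q Hq]. now exists q.
    - exists 0. simpl. lia. }
  destruct (functional_choice _ Hreg) as [center Hcenter].
  set (decode := fun n => let (j, n1) := of_nat n in let (N, n2) := of_nat n1 in
    let (a, n3) := of_nat n2 in let (b, c) := of_nat n3 in (j, N, (a, b, c))).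
  assert (Hdec : forall j N a b c, exists n, decode n = (j, N, (a, b, c))).
  { intros j N a b c. exists (to_nat (j, to_nat (N, to_nat (a, to_nat (b, c))))).
    unfold decode. now rewrite !cancel_of_to. }
  (* n encodes a curve, an integer K = N + 1 and a grid point. The condition j < m inside makes the
     codes of nonexistent curves never bad. *)
  set (Bad := fun n F => let '(j, N, x) := decode n in
    (j < m)%nat /\ curve_bound (center (j, x)) (INR N + 1) (curve (Phi j)) F).
  assert (HKpos : forall N, 0 < INR N + 1) by (intros N; assert (H := pos_INR N); lra).
  assert (HRA : forall F, (forall j, (j < m)%nat -> forall t0,
     ~ real_analytic_at_on_curve F (curve (Phi j)) t0) <-> forall n, ~ Bad n F).
  { intros F. split.
    - intros H n. unfold Bad. destruct (decode n) as [[j N] x]. intros [Hj HB].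
      apply (H j Hj (center (j, x))). now apply (curve_bound_real_analytic _ (INR N + 1)).
    - intros H j Hj t0 HA. apply real_analytic_curve_bound in HA.
      destruct HA as [dl [K0 [Hdl HK0]]].
      destruct (grid_dense t0 dl Hdl) as [a [b [c Hg]]].
      destruct (INR_unbounded K0) as [N HN].
      destruct (Hdec j N a b c) as [n Hn]. apply (H n). unfold Bad. rewrite Hn. split; [easy|].
      apply HK0; [|lra]. apply Hg. now apply (Hcenter (j, (a, b, c))). }
  assert (Hstab : forall n F, ~ Bad n F -> exists rho, 0 < rho /\
    forall G, (forall z, closure Om z -> Cmod (G z - F z) <= rho) -> ~ Bad n G).
  { intros n F. unfold Bad. destruct (decode n) as [[j N] x]. intros HF.
    destruct (Nat.lt_ge_cases j m) as [Hj|Hj].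
    - destruct (curve_bound_stable Om (center (j, x)) (INR N + 1) (curve (Phi j)) F)
        as [rho [Hrho HG]]; [easy|intros t; now apply Hcl|tauto|].
      exists rho. split; [easy|]. intros G HGF [_ HB]. now apply (HG G).
    - exists 1. split; [lra|]. intros G _ [H _]. lia. }
  assert (Hesc : forall n F N0 eps, smooth_tower Om F -> 0 < eps -> exists F', smooth_tower Om F' /\
    (forall l z, (l <= N0)%nat -> closure Om z -> Cmod (F' l z - F l z) <= eps) /\ ~ Bad n (F' O)).
  { intros n F N0 eps HF Heps. unfold Bad. destruct (decode n) as [[j N] x].
    destruct (Nat.lt_ge_cases j m) as [Hj|Hj].
    - destruct (Hcenter (j, x) Hj) as [_ [T [HT Ht]]]. cbn [fst] in Ht.
      destruct (exterior_balls Om (fun k => curve (Phi k)) m j (center (j, x)) T)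
        as [sg [Hsg Hext]]; try easy.
      + intros k Hk Hkj t. now apply Hdisj.
      + intros z Hz. now apply Hbd.
      + intros t. now apply HnOm.
      + destruct (escape Om F (curve (Phi j)) (center (j, x)) T sg (INR N + 1) N0 eps)
          as [F' [HF' [Hclose HB]]]; try easy.
        * intros t. now apply Hcl.
        * exists F'. split; [easy|]. split; [easy|]. intros [_ HB']. now apply HB.
    - exists F. split; [easy|]. split; [|intros [H _]; lia].
      intros l z _ _. toC. replace (F l z - F l z)%C with (RtoC 0) by ring. rewrite Cmod_0. lra. }
  split.
  - intros f Hf N0 eps Heps. destruct (A_infty_smooth_tower Om f Ho Hf) as [T [HT HTf]].
    destruct (baire_smooth_tower Om Bad Ho Hesc Hstab T N0 (eps / 2) HT ltac:(lra))
      as [T' [HT' [Hclose HB]]].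
    exists (T' O). split; [now apply smooth_tower_A_infty|]. split.
    + intros F HF HFT. apply HRA. intros n.
      (* F and T' 0 agree on the closure but may differ elsewhere; stability with difference 0
         transfers the property. *)
      destruct (Hstab n (T' O) (HB n)) as [rho [Hrho HG]]. apply HG. intros z Hz.
      rewrite (closure_eq Om F (T' O) HF (proj1 HT' O) HFT z Hz). toC.
      replace (T' O z - T' O z)%C with (RtoC 0) by ring. rewrite Cmod_0. lra.
    + apply (A_ball_smooth_tower Om f N0 eps T); try easy. intros l z Hl Hz.
      specialize (Hclose l z Hl (closure_incl _ _ Hz)). lra.
  - exists (fun n f => forall F, continuous_on (closure Om) F -> (forall z, Om z -> F z = f z) -> ~ Bad n F).
    split.
    + intros n f Hf HU. destruct (A_infty_smooth_tower Om f Ho Hf) as [T [HT HTf]].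
      destruct (Hstab n (T O)) as [rho [Hrho HG]]; [apply HU; [apply HT|easy]|].
      (* Badness depends on boundary values alone, so the seminorm of order 0 gives a
         neighbourhood. *)
      exists O, rho. split; [easy|]. intros g Hg Hball G HGc HGg. apply HG.
      destruct (A_infty_smooth_tower Om g Ho Hg) as [T' [HT' HTg]].
      apply closure_le; [apply HT|easy|]. intros z Hz. left.
      rewrite (HGg z Hz), <- (HTg z Hz), <- Cnorm_Cmod.
      apply (Hball T T'); [now apply smooth_tower_deriv_tower|now apply smooth_tower_deriv_tower|lia|easy].
    + intros f Hf. split.
      * intros H n F HF HFf. revert n. apply HRA. exact (H F HF HFf).
      * intros H F HF HFf. apply HRA. intros n. now apply H.
Qed.
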